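(* Let $(X,\sigma_X)$, $(Y,\sigma_Y)$ be one-sided full shifts and $\pi:X\to Y$ a one-block factor map. Let $\mathcal F=\{\log f_n\}$ be an almost additive potential on $X$ with bounded variation, $\mu_{\mathcal F}\in M(X,\sigma_X)$ its unique invariant Gibbs measure, and $\nu=\pi\mu_{\mathcal F}$. Then $\nu$ is the unique equilibrium state for the function $P(\sigma_X,\pi,\mathcal F)$ on $Y$, i.e. the unique $m\in M(Y,\sigma_Y)$ maximizing $h_m(\sigma_Y)+\int P(\sigma_X,\pi,\mathcal F)\,dm$; and $\mu_{\mathcal F}$ is the unique relative equilibrium state for $\mathcal F$ over $\nu$.
   Context: A full shift is $\{1,\dots,k\}^{\mathbb N}$ with the left shift and metric $d(x,x')=2^{-j}$, $j$ the longest common prefix length. A factor map is a continuous surjection commuting with the shifts; one-block means $\pi(x)_i$ depends only on $x_i$. Almost additive: continuous $f_n>0$ and $\exists C>0$ with $e^{-C}f_n(x)f_m(\sigma_X^nx)\le f_{n+m}(x)\le e^Cf_n(x)f_m(\sigma_X^nx)$; bounded variation: $\sup_n\sup\{f_n(x)/f_n(x'):x_i=x'_i,1\le i\le n\}<\infty$. Gibbs measure: $\exists C_0$ with $C_0^{-1}<\mu([x_1\cdots x_n])/(e^{-nP_X(\mathcal F)}f_n(x))<C_0$ for all $x,n$, $P_X$ the topological pressure. Relative pressure: $P(\sigma_X,\pi,\mathcal F)(y)=\lim_{\epsilon\to0}\limsup_n\frac1n\log\sup\{\sum_{x\in E}f_n(x):E\text{ an }(n,\epsilon)\text{-separated subset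 of }\pi^{-1}\{y\}\}$. A relative equilibrium state for $\mathcal F$ over $m\in M(Y,\sigma_Y)$ is $\bar\mu\in M(X,\sigma_X)$ with $\pi\bar\mu=m$ maximizing $h_{\bar\mu}(\sigma_X)-h_m(\sigma_Y)+\lim_n\frac1n\int\log f_nd\bar\mu$ among all invariant $\bar\mu$ with $\pi\bar\mu=m$. *)

(* Defs.v *)
From HB Require Import structures.
From mathcomp Require Import all_boot all_order all_algebra.
From mathcomp Require Import all_classical all_reals all_analysis.
Set Implicit Arguments.
Unset Strict Implicit.
Unset Printing Implicit Defensive.
Import Order.TTheory GRing.Theory Num.Theory.
Import numFieldNormedType.Exports.
Local Open Scope classical_set_scope.
Local Open Scope ring_scope.

(* One-sided full shift on the alphabet 'I_k.+1 (i.e. k+1 >= 1 symbols; *)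
(* the paper's {1,...,K} with K = k+1).  Coordinates are indexed from 0. *)

Definition shseq (k : nat) := nat -> 'I_k.+1.
HB.instance Definition _ (k : nat) := Choice.copy (shseq k) (nat -> 'I_k.+1).
HB.instance Definition _ (k : nat) :=
  isPointed.Build (shseq k) (fun _ => ord0).

Definition cyl (k : nat) (n : nat) (x : shseq k) : set (shseq k) :=
  [set x' | forall i, (i < n)%N -> x' i = x i].

Definition cylinders (k : nat) : set (set (shseq k)) :=
  [set C | exists n x, C = cyl n x].

(* the full shift with its Borel sigma-algebra (= the sigma-algebra
   generated by the cylinders) *)
Definition Shift (k : nat) := g_sigma_algebraType (@cylinders k).

HB.instance Definition _ (k : nat) :=
  Measurable.copy (Shift k) (g_sigma_algebraType (@cylinders k)).

Definition spt (k : nat) : Shift k := fun _ => ord0.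

Definition shift (k : nat) (x : Shift k) : Shift k := fun n => x n.+1.

Definition sdist (R : realType) (k : nat) (x x' : Shift k) : R :=
  match pselect (exists j, x j != x' j) with
  | left H => (2^-1) ^+ (ex_minn H)
  | right _ => 0
  end.

Definition bowen (R : realType) (k : nat) (n : nat) (x x' : Shift k) : R :=
  \big[Num.max/0]_(i < n) sdist R (iter i (@shift k) x) (iter i (@shift k) x').

Definition dcont (R : realType) (k : nat) (g : Shift k -> R) : Prop :=
  forall x (e : R), 0 < e -> exists2 del : R, 0 < del &
    forall x', sdist R x x' < del -> `|g x' - g x| < e.

Definition separated (R : realType) (k : nat) (Z : set (Shift k))
  (n : nat) (eps : R) (E : seq (Shift k)) : Prop :=
  (forall i, (i < size E)%N -> Z (nth (spt k) E i)) /\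
  (forall i j, (i < j)%N -> (j < size E)%N ->
     eps < bowen R n (nth (spt k) E i) (nth (spt k) E j)).

Definition sep_sup (R : realType) (k : nat) (f : nat -> Shift k -> R)
  (Z : set (Shift k)) (n : nat) (eps : R) : \bar R :=
  ereal_sup [set (\sum_(x <- E) f n x)%:E | E in separated Z n eps].

Definition pressure_on (R : realType) (k : nat) (f : nat -> Shift k -> R)
  (Z : set (Shift k)) : \bar R :=
  lim ((fun eps : R =>
          limn_esup (fun n : nat =>
            ((n%:R)^-1)%:E * lne (sep_sup f Z n eps))%E) @ 0^'+).

Definition top_pressure (R : realType) (k : nat) (f : nat -> Shift k -> R)
  : \bar R := pressure_on f setT.

Definition rel_pressure (R : realType) (k l : nat) (pi : Shift k -> Shift l)
  (f : nat -> Shift k -> R) (y : Shift l) : \bar R :=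
  pressure_on f (pi @^-1` [set y]).

Definition shift_invariant (R : realType) (k : nat)
  (mu : set (Shift k) -> \bar R) : Prop :=
  forall A : set (Shift k), measurable A -> mu (@shift k @^-1` A) = mu A.

Definition meas_partition (k : nat) (m : nat) (A : 'I_m -> set (Shift k))
  : Prop :=
  (forall i, measurable (A i)) /\
  (forall i j, i != j -> A i `&` A j = set0) /\
  (\bigcup_i A i = setT).

Definition join_entropy (R : realType) (k : nat) (mu : set (Shift k) -> \bar R)
  (m : nat) (A : 'I_m -> set (Shift k)) (n : nat) : R :=
  \sum_(w : {ffun 'I_n -> 'I_m})
    (let p := fine (mu (\bigcap_(i in [set: 'I_n])
                          (iter i (@shift k) @^-1` A (w i)))) in
     - (p * ln p)).

Definition part_entropy (R : realType) (k : nat) (mu : set (Shift k) -> \bar R)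
  (m : nat) (A : 'I_m -> set (Shift k)) : R :=
  limn (fun n : nat => ((n%:R)^-1 * join_entropy mu A n : R)).

Definition ks_entropy (R : realType) (k : nat) (mu : set (Shift k) -> \bar R)
  : R :=
  sup [set h | exists m (A : 'I_m -> set (Shift k)),
                 meas_partition A /\ h = part_entropy mu A].

Definition almost_additive (R : realType) (k : nat) (f : nat -> Shift k -> R)
  : Prop :=
  (forall n, (0 < n)%N -> dcont (f n)) /\
  (forall n x, (0 < n)%N -> 0 < f n x) /\
  (exists2 C : R, 0 < C &
     forall n m x, (0 < n)%N -> (0 < m)%N ->
       expR (- C) * f n x * f m (iter n (@shift k) x) <= f (n + m)%N x /\
       f (n + m)%N x <= expR C * f n x * f m (iter n (@shift k) x)).

Definition bounded_var_potential (R : realType) (k : nat) (f : nat -> Shift k -> R)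
  : Prop :=
  exists M : R, forall n x x', (0 < n)%N ->
    (forall i, (i < n)%N -> x i = x' i) -> f n x / f n x' <= M.

Definition gibbs (R : realType) (k : nat) (f : nat -> Shift k -> R)
  (mu : set (Shift k) -> \bar R) : Prop :=
  exists C0 : R, forall x n, (0 < n)%N ->
    C0^-1 < fine (mu (cyl n x)) /
              (expR (- (n%:R * fine (top_pressure f))) * f n x) < C0.

Definition one_block_factor (R : realType) (k l : nat)
  (pi : Shift k -> Shift l) : Prop :=
  [/\ (forall x (e : R), 0 < e -> exists2 del : R, 0 < del &
        forall x', sdist R x x' < del -> sdist R (pi x) (pi x') < e),
      (forall y, exists x, pi x = y),
      (forall x, pi (shift x) = shift (pi x)) &
      (forall x x' i, x i = x' i -> pi x i = pi x' i)].
Definition pushes_to (R : realType) (k l : nat) (pi : Shift k -> Shift l)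
  (mu : set (Shift k) -> \bar R) (m : set (Shift l) -> \bar R) : Prop :=
  forall B : set (Shift l), measurable B -> mu (pi @^-1` B) = m B.

Definition same_measure (R : realType) (k : nat)
  (m1 m2 : set (Shift k) -> \bar R) : Prop :=
  forall A : set (Shift k), measurable A -> m1 A = m2 A.

Definition eq_functional (R : realType) (k l : nat) (pi : Shift k -> Shift l)
  (f : nat -> Shift k -> R) (m : {measure set (Shift l) -> \bar R}) : \bar R :=
  ((ks_entropy m)%:E + \int[m]_y rel_pressure pi f y)%E.

Definition rel_functional (R : realType) (k l : nat)
  (f : nat -> Shift k -> R) (mu : {measure set (Shift k) -> \bar R})
  (m : set (Shift l) -> \bar R) : \bar R :=
  ((ks_entropy mu - ks_entropy m)%:E +
   limn (fun n : nat => ((n%:R)^-1)%:E * \int[mu]_x (ln (f n x))%:E))%E.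

(* Main.v *)
(** The Gibbs measure mu is quasi-Bernoulli: the masses q of its cylinders satisfy
    q(st) = q(s) q(t) up to a constant factor K, and f_n = e^(nP) q on cylinders of
    length n up to a constant. The masses of its one-block image nu inherit this.
    For an invariant m with cylinder masses p, let L_n = - sum p ln q and
    H_n = - sum p ln p over the words of length n. Then H_n / n decreases to h(m) (the
    Kolmogorov-Sinai entropy, as every partition is close to a partition into
    cylinders), L_n is almost additive, and h(m) <= lim L_n / n. In case of equality
    the relative entropy L_n - H_n stays below ln K; this forces p >= c q for some
    c > 0, and removing from p the largest possible multiple of q gives p = q.
    Up to a constant both functionals of the theorem equal h(m) - lim L_n / n.
    On X this is immediate. On Y the relative pressure at y is
    P + limsup 1/n ln nu[y_1 ... y_n], and its integral is - lim L_n / n + P by Fatou's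
    lemma in one direction and the Katznelson-Weiss covering argument in the other. *)
From Pilot Require Import Defs.
From HB Require Import structures.
From mathcomp Require Import all_boot all_order all_algebra.
From mathcomp Require Import all_classical all_reals all_analysis.
From mathcomp Require Import measurable_realfun lra ring.
Set Implicit Arguments.
Unset Strict Implicit.
Unset Printing Implicit Defensive.
Import Order.TTheory GRing.Theory Num.Theory.
Import numFieldNormedType.Exports.
Local Open Scope classical_set_scope.
Local Open Scope ring_scope.
Import Pilot.Defs.

(** The competing measure m is an arbitrary invariant measure, so neither the pointwise rate of q
    along m nor the relative pressure need be constant almost everywhere; the argument works with
    averages over words of length n and constants uniform in n. The bound ln K on L_n - H_n pairs
    two one-sided estimates: subadditivity gives H_n >= n h(m), superadditivity up to ln K gives L_n
    <= n lim L_n / n + ln K, and equal rates cancel the linear terms. The bound p >= c q comes from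
    growth: if p(v) < c q(v) for a single word v, every further block of length |v| raises L_n - H_n
    by the same positive amount. Here c = (1 - e^(-1)) / K, where K pays for replacing the
    conditional mass q(uv) / q(u) by q(v) and 1 - e^(-1) is the gain from tilting Gibbs' inequality
    at v. As c depends on K alone, it applies to the remainder of p as well, so the removal of
    multiples of q can only end at p = q. *)

(** * Gibbs' inequality *)

(** This is [ln z <= z - 1] at [z = s * y / x], multiplied by [x]. The weight 1 gives the usual
    inequality; the weight [e^-1] cancels [1 + ln s] and leaves only [- s * y] on the left. *)
Lemma gibbs_pointwise (R : realType) (x y s : R) :
  0 <= x -> 0 <= y -> (y = 0 -> x = 0) -> 0 < s ->
  x * (1 + ln s) - s * y <= x * ln x - x * ln y.
Proof.
move=> x0 y0 xy s0; have [->|xn0] := eqVneq x 0.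
  by rewrite !mul0r subr0 sub0r oppr_le0 mulr_ge0 // ltW.
have yn0 : y != 0 by apply: contra_neq xn0 => /xy.
have xp : 0 < x by rewrite lt0r xn0.
have yp : 0 < y by rewrite lt0r yn0.
have zp : 0 < s * y / x by rewrite divr_gt0 ?mulr_gt0.
have : ln (s * y / x) <= s * y / x - 1.
  by have := expR_ge1Dx (ln (s * y / x)); rewrite lnK ?posrE //; lra.
rewrite ln_div ?posrE ?mulr_gt0 // lnM ?posrE // => h.
have := ler_wpM2l x0 h.
rewrite (_ : x * (s * y / x - 1) = s * y - x); last by field.
lra.
Qed.

Lemma gibbs_ineq (R : realType) (T : Type) (r : seq T) (x y : T -> R) :
  (forall t, 0 <= x t) -> (forall t, 0 <= y t) -> (forall t, y t = 0 -> x t = 0) ->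
  \sum_(t <- r) y t <= \sum_(t <- r) x t ->
  - (\sum_(t <- r) x t * ln (x t)) <= - (\sum_(t <- r) x t * ln (y t)).
Proof.
move=> x0 y0 xy yx; rewrite lerN2 -subr_ge0 -sumrB.
apply: (@le_trans _ _ (\sum_(t <- r) (x t - y t))).
  by rewrite sumrB subr_ge0.
apply: ler_sum => t _.
by have := gibbs_pointwise (x0 t) (y0 t) (xy t) ltr01; rewrite ln1 addr0 mulr1 mul1r.
Qed.

(** * Invariant laws on finite words and their cross-entropies *)

Section Words.
Variables (R : realType) (A : finType).
Implicit Types (p q F G : seq A -> R).

(** Words are plain lists, so that length [n + m] splits by concatenation without casts. *)
Fixpoint words (n : nat) : seq (seq A) :=
  if n is n'.+1 then [seq a :: w | a <- enum A, w <- words n'] else [:: [::]].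

Lemma sum_words0 F : \sum_(w <- words 0) F w = F [::].
Proof. by rewrite /= big_seq1. Qed.

Lemma sum_wordsS n F :
  \sum_(w <- words n.+1) F w = \sum_(a : A) \sum_(w <- words n) F (a :: w).
Proof. by rewrite [words _]/= big_allpairs_dep /= big_enum. Qed.

Lemma sum_words_cat n m F :
  \sum_(w <- words (n + m)) F w
  = \sum_(u <- words n) \sum_(v <- words m) F (u ++ v).
Proof.
elim: n F => [|n IH] F; first by rewrite sum_words0.
by rewrite addSn !sum_wordsS; apply: eq_bigr => a _; rewrite IH.
Qed.

Lemma mem_words n w : (w \in words n) = (size w == n).
Proof.
elim: n w => [|n IH] [|a w]; rewrite ?in_nil ?eqxx //.
  by apply/negbTE/allpairsPdep => -[a [v [_ _]]].
rewrite eqSS -IH; apply/allpairsPdep/idP => [[b [v [_ vn]]] [_ ->] //|wn].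
by exists a, w; rewrite mem_enum.
Qed.

Lemma words_uniq n : uniq (words n).
Proof.
elim: n => [|n IH] //=; apply: allpairs_uniq_dep => //.
- by rewrite enum_uniq.
- by move=> [a u] [b v] /= _ _ [-> ->].
Qed.

Lemma sum_words_ge n F w : size w = n -> (forall v, 0 <= F v) ->
  F w <= \sum_(v <- words n) F v.
Proof.
move=> wn F0; rewrite (bigD1_seq w) ?mem_words ?wn ?eqxx ?words_uniq //=.
by rewrite lerDl sumr_ge0.
Qed.

(** The axioms of the cylinder masses of an invariant probability: [inv_rcons] is additivity over
    the next letter, [inv_cons] is invariance under the shift. *)
Record inv_dist p : Prop := InvDist {
  inv_ge0 : forall s, 0 <= p s;
  inv_nil : p [::] = 1;
  inv_rcons : forall s, \sum_(a : A) p (rcons s a) = p s;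
  inv_cons : forall s, \sum_(a : A) p (a :: s) = p s }.

Lemma inv_catr p s m : inv_dist p -> \sum_(v <- words m) p (s ++ v) = p s.
Proof.
move=> ip; elim: m s => [|m IH] s; first by rewrite sum_words0 cats0.
rewrite sum_wordsS -[RHS](inv_rcons ip); apply: eq_bigr => a _.
by rewrite -IH; apply: eq_bigr => v _; rewrite cat_rcons.
Qed.

Lemma inv_catl p s n : inv_dist p -> \sum_(u <- words n) p (u ++ s) = p s.
Proof.
move=> ip; elim: n => [|n IH]; first by rewrite sum_words0.
rewrite sum_wordsS exchange_big -[RHS]IH; apply: eq_bigr => u _.
exact: (inv_cons ip).
Qed.

Lemma inv_sum p n : inv_dist p -> \sum_(u <- words n) p u = 1.
Proof.
by move=> ip; rewrite -(inv_nil ip) -(inv_catr [::] n ip).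
Qed.

Lemma inv_le_prefix p s t : inv_dist p -> p (s ++ t) <= p s.
Proof.
move=> ip; rewrite -[leRHS](inv_catr s (size t) ip).
exact: (@sum_words_ge _ (fun v => p (s ++ v)) t erefl (fun v => inv_ge0 ip _)).
Qed.

Lemma inv_le_suffix p s t : inv_dist p -> p (s ++ t) <= p t.
Proof.
move=> ip; rewrite -[leRHS](inv_catl t (size s) ip).
exact: (@sum_words_ge _ (fun v => p (v ++ t)) s erefl (fun v => inv_ge0 ip _)).
Qed.

Lemma inv_le1 p s : inv_dist p -> p s <= 1.
Proof. by move=> ip; rewrite -(inv_nil ip); exact: (@inv_le_prefix _ [::]). Qed.

Lemma inv_sum_prefix p n m G : inv_dist p ->
  \sum_(u <- words n) \sum_(v <- words m) p (u ++ v) * G u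
  = \sum_(u <- words n) p u * G u.
Proof.
move=> ip; apply: eq_bigr => u _.
by rewrite -mulr_suml (inv_catr _ _ ip).
Qed.

Lemma inv_sum_suffix p n m G : inv_dist p ->
  \sum_(u <- words n) \sum_(v <- words m) p (u ++ v) * G v
  = \sum_(v <- words m) p v * G v.
Proof.
move=> ip; rewrite exchange_big; apply: eq_bigr => v _.
by rewrite -mulr_suml (inv_catl _ _ ip).
Qed.

Definition quasi_bernoulli q K :=
  [/\ forall s, 0 < q s, forall s t, q s * q t <= K * q (s ++ t) &
      forall s t, q (s ++ t) <= K * (q s * q t)].

(** Cross-entropy over words of length [n]: [H_n] when [q] is [p], [L_n] for the Gibbs masses
    [q]. *)
Definition xent n p q : R := - \sum_(w <- words n) p w * ln (q w).

Lemma xent_ge0 n p q : (forall s, 0 <= p s) -> (forall s, q s <= 1) ->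
  0 <= xent n p q.
Proof.
move=> p0 q1; rewrite /xent -sumrN sumr_ge0 // => w _.
rewrite -mulrN mulr_ge0 // oppr_ge0 ln_le0 //.
Qed.

Lemma xent_self_le n p q : inv_dist p -> inv_dist q -> (forall s, 0 < q s) ->
  xent n p p <= xent n p q.
Proof.
move=> ip iq q0; apply: gibbs_ineq.
- exact: inv_ge0 ip.
- exact: inv_ge0 iq.
- by move=> t qt; have := q0 t; rewrite qt ltxx.
- by rewrite !inv_sum.
Qed.

(** Gibbs' inequality for the joint law of two adjacent blocks against the product of their
    marginals, which invariance identifies with the laws of initial blocks. *)
Lemma xent_subadd n m p : inv_dist p -> xent (n + m) p p <= xent n p p + xent m p p.
Proof.
move=> ip; have p0 := inv_ge0 ip.
rewrite /xent -opprD -(@inv_sum_prefix p n m (fun u => ln (p u)) ip).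
rewrite -(@inv_sum_suffix p n m (fun u => ln (p u)) ip) sum_words_cat -big_split /=.
under [X in _ <= - X]eq_bigr do rewrite -big_split /=.
pose r := [seq (u, v) | u <- words n, v <- words m].
have sumr (F : seq A -> seq A -> R) : \sum_(w <- r) F w.1 w.2 = \sum_(u <- words n) \sum_(v <- words m) F u v.
  by rewrite big_allpairs_dep.
rewrite -(sumr (fun u v => p (u ++ v) * ln (p (u ++ v)))).
rewrite -(sumr (fun u v => p (u ++ v) * ln (p u) + p (u ++ v) * ln (p v))).
apply: le_trans (@gibbs_ineq R _ _ _ (fun w => p w.1 * p w.2) _ _ _ _) _ => /=.
- by move=> w; exact: p0.
- by move=> w; rewrite mulr_ge0.
- move=> w /eqP; rewrite mulf_eq0 => /orP[] /eqP w0; apply/eqP; rewrite eq_le p0 andbT -w0.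
    exact: inv_le_prefix.
  exact: inv_le_suffix.
- rewrite (sumr (fun u v => p u * p v)) (sumr (fun u v => p (u ++ v))).
  under eq_bigr do rewrite -mulr_sumr inv_sum // mulr1.
  rewrite inv_sum // -(inv_sum (n + m) ip) sum_words_cat.
  exact: lexx.
rewrite lerN2; apply: ler_sum => w _.
(* Where the joint mass is positive both marginals are, so the logarithm splits; elsewhere the
   coefficient is 0. *)
have [w0|wn0] := eqVneq (p (w.1 ++ w.2)) 0; first by rewrite w0 !mul0r addr0.
have wp : 0 < p (w.1 ++ w.2) by rewrite lt0r wn0 p0.
rewrite -mulrDr lnM //= posrE; apply: lt_le_trans wp _.
  exact: inv_le_prefix.
exact: inv_le_suffix.
Qed.

Section CrossEntropy.
Variables (p q : seq A -> R) (K : R).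
Hypotheses (ip : inv_dist p) (iq : inv_dist q) (bq : quasi_bernoulli q K).

Lemma quasi_bernoulli_ge1 : 1 <= K.
Proof.
have [_ h _] := bq; have := h [::] [::].
by rewrite (inv_nil iq) !mulr1.
Qed.

Let K0 : 0 < K := lt_le_trans ltr01 quasi_bernoulli_ge1.

Let q0 s : 0 < q s. Proof. by case: bq. Qed.

Lemma ln_quasi_bernoulli_ge s t : ln (q s) + ln (q t) - ln K <= ln (q (s ++ t)).
Proof.
case: bq => _ h _; have := h s t; rewrite -ler_ln ?posrE ?mulr_gt0 //.
by rewrite !lnM ?posrE // lerBlDl.
Qed.

Lemma ln_quasi_bernoulli_le s t : ln (q (s ++ t)) <= ln (q s) + ln (q t) + ln K.
Proof.
case: bq => _ _ h; have := h s t; rewrite -ler_ln ?posrE ?mulr_gt0 //.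
by rewrite !lnM ?posrE ?mulr_gt0 // addrC.
Qed.

Let sum_split n m (c : R) :
  \sum_(u <- words n) \sum_(v <- words m) p (u ++ v) * (ln (q u) + ln (q v) + c)
  = - xent n p q - xent m p q + c.
Proof.
rewrite /xent !opprK -(@inv_sum_prefix p n m (fun u => ln (q u)) ip).
rewrite -(@inv_sum_suffix p n m (fun u => ln (q u)) ip) -big_split /=.
rewrite -[X in _ = _ + X]mul1r -(inv_sum n ip) mulr_suml.
rewrite -(@inv_sum_prefix p n m (fun=> c) ip) -!big_split /=.
apply: eq_bigr => u _; rewrite -!big_split /=.
by apply: eq_bigr => v _; rewrite !mulrDr.
Qed.

Lemma xent_almost_subadd n m : xent (n + m) p q <= xent n p q + xent m p q + ln K.
Proof.
rewrite -lerN2 !opprD -sum_split {1}/xent opprK sum_words_cat.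
do 2!apply: ler_sum => ? _.
by rewrite ler_wpM2l ?(inv_ge0 ip) // ln_quasi_bernoulli_ge.
Qed.

Lemma xent_almost_superadd n m : xent n p q + xent m p q - ln K <= xent (n + m) p q.
Proof.
rewrite -lerN2 !opprD (opprK (ln K)) -sum_split {1}/xent opprK sum_words_cat.
do 2!apply: ler_sum => ? _.
by rewrite ler_wpM2l ?(inv_ge0 ip) // ln_quasi_bernoulli_le.
Qed.

End CrossEntropy.

End Words.

(** * Subadditive limits, entropy rates and the growth of relative entropy *)

(** The limit is the infimum of [a n / n] over positive [n], which also yields the lower bound at
    every [n]. *)
Lemma fekete (R : realType) (a : nat -> R) :
  (forall n m, a (n + m)%N <= a n + a m) -> (forall n, 0 <= a n) ->
  exists2 h : R, forall n, n%:R * h <= a n &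
    (fun n => n%:R^-1 * a n) @ \oo --> h.
Proof.
move=> asub a0; pose E : set R := [set a n.+1 / n.+1%:R | n in setT].
have Einf : has_inf E.
  split; first by exists (a 1%N / 1%:R), 0%N.
  by exists 0 => _ [n _ <-]; rewrite divr_ge0.
have hle n : n%:R * inf E <= a n.
  case: n => [|n]; first by rewrite mul0r.
  by rewrite mulrC -ler_pdivlMr ?ltr0n //; apply: (ge_inf Einf.2); exists n.
exists (inf E) => //.
(* Division with remainder by [N.+1]; the sum over all [i <= N] bounds the remainder term whatever
   its length. *)
have abound N n : a n <= (n %/ N.+1)%:R * a N.+1 + \sum_(i < N.+1) a i.
  have step j r : a (j * N.+1 + r)%N <= j%:R * a N.+1 + a r.
    elim: j => [|j IH]; first by rewrite mul0n mul0r add0n add0r.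
    rewrite mulSn -addnA -natr1 mulrDl mul1r.
    by have := asub N.+1 (j * N.+1 + r)%N; lra.
  rewrite {1}(divn_eq n N.+1); apply: (le_trans (step _ _)); rewrite lerD2l.
  have lt : (n %% N.+1 < N.+1)%N by rewrite ltn_mod.
  by rewrite (bigD1 (Ordinal lt)) //= lerDl sumr_ge0.
apply/cvgrPdist_le => e e0.
have e20 : 0 < e / 2 by rewrite divr_gt0.
have [_ [N _ <-] Nlt] := inf_adherent e20 Einf.
set M := \sum_(i < N.+1) a i in abound *.
have M0 : 0 <= M by apply: sumr_ge0.
(* Past this index the remainder costs at most [e / 2] per unit of length; the other [e / 2] is the
   slack in the choice of [N]. *)
exists (Num.truncn (2 * M / e)).+1 => // n /= nbig.
have n0 : 0 < n%:R :> R by rewrite ltr0n; apply: leq_ltn_trans nbig.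
rewrite ler_distlC; apply/andP; split.
  rewrite lerBlDr ler_wpDr ?(ltW e0) // mulrC ler_pdivlMr // mulrC; exact: hle.
rewrite mulrC ler_pdivrMr //; apply: (le_trans (abound N n)).
have Mn : M <= e / 2 * n%:R.
  have : 2 * M / e < n%:R.
    by apply: lt_le_trans (truncnS_gt _) _; rewrite ler_nat.
  by rewrite ltr_pdivrMr // => h; lra.
have : (n %/ N.+1)%:R * a N.+1 <= n%:R * (a N.+1 / N.+1%:R).
  by rewrite mulrA ler_pdivlMr ?ltr0n // mulrAC -natrM ler_wpM2r // ler_nat leq_divM.
move=> h; have h2 := ltW Nlt; have := ler_wpM2l (ltW n0) h2.
rewrite mulrDr => h3; rewrite -/M mulrDl.
by move: h h3 Mn; move: (_ * a N.+1) (_ * (a N.+1 / _)) => t u; lra.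
Qed.

Lemma cvg_invn0 (R : realType) : (fun n : nat => n%:R^-1 : R) @ \oo --> (0 : R).
Proof.
apply/gtr0_cvgV0; last exact: cvgr_idn.
by exists 1%N => // n /= n0; rewrite ltr0n.
Qed.

Section EntropyRates.
Variables (R : realType) (A : finType).
Implicit Types (p q : seq A -> R).

Definition xent_rate p q : R := limn (fun n => n%:R^-1 * xent n p q).

Lemma entropy_rate_spec p : inv_dist p ->
  (forall n, n%:R * xent_rate p p <= xent n p p) /\
  ((fun n => n%:R^-1 * xent n p p) @ \oo --> xent_rate p p).
Proof.
move=> ip.
have [h hle hcvg] := fekete (fun n m => xent_subadd n m ip)
  (fun n => xent_ge0 n (inv_ge0 ip) (fun s => inv_le1 s ip)).
by rewrite /xent_rate (cvg_lim _ hcvg).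
Qed.

Lemma entropy_rate_ge0 p : inv_dist p -> 0 <= xent_rate p p.
Proof.
move=> ip; have [_ h] := entropy_rate_spec ip.
apply: limr_ge; first by apply/cvg_ex; exists (xent_rate p p).
apply: nearW => n; by rewrite mulr_ge0 // xent_ge0 //; [exact: inv_ge0 | move=> s; exact: inv_le1].
Qed.

(* Conditionally on each prefix u, the Gibbs inequality is applied with the
   weight e^-1 on the word v and 1 on the other words of the same length. *)
Lemma relent_step p q K n v : inv_dist p -> inv_dist q -> quasi_bernoulli q K ->
  (1 - expR (-1)) / K * q v - p v <=
  (xent (n + size v) p q - xent (n + size v) p p) - (xent n p q - xent n p p).
Proof.
move=> ip iq bq; have [q0 qsup _] := bq; have p0 := inv_ge0 ip.
have K0 : 0 < K := lt_le_trans ltr01 (quasi_bernoulli_ge1 iq bq).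
have e0 : 0 <= 1 - expR (-1) :> R.
  by rewrite subr_ge0 -[leRHS](@expR0 R) ler_expR lerN10.
set b := size v; set c := _ / K.
have c0 : 0 <= c.
  by rewrite divr_ge0 ?(ltW K0).
have pt u w : p (u ++ w) - p u * q (u ++ w) / q u
    + (if w == v then c * q v * p u - p (u ++ v) else 0)
    <= p (u ++ w) * ln (p (u ++ w)) - p (u ++ w) * ln (q (u ++ w))
       - p (u ++ w) * ln (p u) + p (u ++ w) * ln (q u).
  have [pu0|pun0] := eqVneq (p u) 0.
    have pw0 s : p (u ++ s) = 0.
      by apply/eqP; rewrite eq_le p0 andbT -pu0 inv_le_prefix.
    by rewrite !pw0 pu0 !(mul0r, mulr0, subr0, addr0); case: ifP.
  have pu : 0 < p u by rewrite lt0r pun0 p0.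
  (* [y] keeps [p] on the prefix and continues with the conditional law of [q]; its sum over [w] is
     [p u]. *)
  pose y := p u * q (u ++ w) / q u.
  have y0 : 0 < y by rewrite divr_gt0 ?mulr_gt0.
  have yx : y = 0 -> p (u ++ w) = 0 by move=> h; move: y0; rewrite h ltxx.
  pose s : R := if w == v then expR (-1) else 1.
  have s0 : 0 < s by rewrite /s; case: ifP => _ //; exact: expR_gt0.
  have := gibbs_pointwise (p0 (u ++ w)) (ltW y0) yx s0.
  rewrite {2}/y ln_div ?posrE ?mulr_gt0 // lnM ?posrE // -/y => main.
  apply: le_trans (le_trans main _); last by rewrite !mulrDr mulrN; lra.
  rewrite /s; case: eqP => [wv|_]; last by rewrite ln1 !addr0 mulr1 mul1r.
  rewrite expRK subrr mulr0 wv.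
  (* Quasi-Bernoulli gives [q (u ++ v) / q u >= q v / K]; this is where [K] enters the constant. *)
  suff : c * q v * p u <= (1 - expR (-1)) * y by rewrite -wv mulrBl mul1r /y; lra.
  rewrite /y wv (_ : c * q v * p u = (1 - expR (-1)) * (p u * (q v / K))); last first.
    by rewrite /c; ring.
  rewrite -[p u * q (u ++ v) / q u]mulrA ler_wpM2l ?e0 //.
  rewrite ler_wpM2l // ler_pdivrMr // mulrAC ler_pdivlMr // mulrC.
  by rewrite [leRHS]mulrC.
rewrite /xent !opprK [X in _ <= X](_ : _ = \sum_(u <- words A n) \sum_(w <- words A b)
  (p (u ++ w) * ln (p (u ++ w)) - p (u ++ w) * ln (q (u ++ w))
       - p (u ++ w) * ln (p u) + p (u ++ w) * ln (q u))); last first.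
  rewrite !sum_words_cat -(inv_sum_prefix n b (fun u => ln (q u)) ip).
  rewrite -(inv_sum_prefix n b (fun u => ln (p u)) ip).
  under [RHS]eq_bigr do rewrite big_split /= sumrB sumrB.
  by rewrite big_split /= !sumrB; lra.
apply: le_trans (ler_sum _ (fun u _ => ler_sum _ (fun w _ => pt u w))).
under eq_bigr => u _.
  rewrite big_split /= sumrB (inv_catr _ _ ip) -mulr_suml -mulr_sumr (inv_catr _ _ iq).
  rewrite mulfK ?gt_eqF // subrr add0r.
  rewrite (bigD1_seq v) ?mem_words ?words_uniq //= eqxx big1 ?addr0; last first.
    by move=> w /negbTE ->.
  over.
by rewrite sumrB -mulr_sumr inv_sum // mulr1 (inv_catl _ _ ip).
Qed.

Lemma bounded_relent_minorization p q K B v :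
  inv_dist p -> inv_dist q -> quasi_bernoulli q K ->
  (forall n, xent n p q - xent n p p <= B) ->
  (1 - expR (-1)) / K * q v <= p v.
Proof.
move=> ip iq bq Dle; rewrite leNgt; apply/negP; rewrite -subr_gt0.
set d := _ - _ => d0.
(* At length 0 both entropies vanish, and the increments [d] add up along multiples of [size v]. *)
have step j : j%:R * d <= xent (j * size v) p q - xent (j * size v) p p.
  elim: j => [|j IH].
    by rewrite mul0n mul0r /xent !sum_words0 (inv_nil ip) (inv_nil iq) subrr.
  rewrite mulSn addnC -natr1 mulrDl mul1r.
  by have := relent_step (j * size v) v ip iq bq; rewrite -/d => h; lra.
pose j := (Num.truncn (B / d)).+1.
have : B / d < j%:R by exact: truncnS_gt.
by rewrite ltr_pdivrMr // ltNge (le_trans (step j) (Dle _)).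
Qed.

End EntropyRates.

(** * Equality of rates forces equality of laws *)

Section VariationalUniqueness.
Variables (R : realType) (A : finType).
Implicit Types (p q : seq A -> R).

(** Both laws have total mass 1 at each length, so the nonnegative differences sum to 0. *)
Lemma inv_dist_le_eq p q : inv_dist p -> inv_dist q -> (forall s, q s <= p s) -> p = q.
Proof.
move=> ip iq qp; apply/funext => s; apply/eqP; rewrite eq_le qp andbT -subr_le0.
have h v : 0 <= p v - q v by rewrite subr_ge0.
apply: le_trans (@sum_words_ge _ _ _ (fun v => p v - q v) s erefl h) _.
by rewrite sumrB !inv_sum // subrr.
Qed.

(** The second component when [p] is decomposed as a convex combination of [q], with weight [c], and
    another law. *)
Definition remainder p q c s : R := (p s - c * q s) / (1 - c).

Lemma inv_dist_sub p q c : inv_dist p -> inv_dist q -> c < 1 ->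
  (forall s, c * q s <= p s) -> inv_dist (remainder p q c).
Proof.
move=> ip iq c1 cqp; have d0 : 0 < 1 - c by rewrite subr_gt0.
rewrite /remainder; split=> [s||s|s].
- by rewrite divr_ge0 ?(ltW d0) // subr_ge0.
- by rewrite (inv_nil ip) (inv_nil iq) mulr1 divff // gt_eqF.
- by rewrite -mulr_suml sumrB -mulr_sumr (inv_rcons ip) (inv_rcons iq).
- by rewrite -mulr_suml sumrB -mulr_sumr (inv_cons ip) (inv_cons iq).
Qed.

(** Crude estimates suffice, as the bound only has to stay uniform in [n]: the remainder is at most
    [p / (1 - c)], and [p / q >= c] controls the part [c * q * ln (p / q)] that is taken out. *)
Lemma relent_sub_le p q c n : inv_dist p -> inv_dist q -> (forall s, 0 < q s) ->
  0 < c -> c < 1 -> (forall s, c * q s <= p s) ->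
  xent n (remainder p q c) q - xent n (remainder p q c) (remainder p q c) <=
    (xent n p q - xent n p p - c * ln c) / (1 - c) - ln (1 - c).
Proof.
move=> ip iq q0 c0 c1 cqp; set p' := remainder p q c; have d0 : 0 < 1 - c by rewrite subr_gt0.
have ip' : inv_dist p' := inv_dist_sub ip iq c1 cqp.
have pp s : 0 < p s by apply: lt_le_trans (cqp s); rewrite mulr_gt0.
have pt s : p' s * ln (p' s) - p' s * ln (q s) <=
  (p s * ln (p s) - p s * ln (q s) - q s * (c * ln c)) / (1 - c) - p' s * ln (1 - c).
  have p'0 := inv_ge0 ip' s.
  have h1 : p' s * ln (p' s) <= p' s * (ln (p s) - ln (1 - c)).
    have [->|p'n0] := eqVneq (p' s) 0; first by rewrite !mul0r.
    have p'p : 0 < p' s by rewrite lt0r p'n0.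
    rewrite ler_wpM2l // -ln_div ?posrE // ler_ln ?posrE // ?divr_gt0 //.
    by rewrite ler_pM2r ?invr_gt0 // gerBl mulr_ge0 // ltW.
  have h2 : ln c <= ln (p s) - ln (q s).
    by rewrite lerBrDr -lnM ?posrE // ler_ln ?posrE ?mulr_gt0.
  have h3 : p' s * (ln (p s) - ln (q s)) <=
      (p s * ln (p s) - p s * ln (q s) - q s * (c * ln c)) / (1 - c).
    rewrite /p' /remainder mulrAC ler_pM2r ?invr_gt0 //.
    have := ler_wpM2l (ltW (mulr_gt0 c0 (q0 s))) h2.
    by rewrite mulrBl mulrBr => h; rewrite mulrCA mulrA; lra.
  by move: h1 h3; rewrite !mulrBr; lra.
have := ler_sum (words A n) (fun s (_ : true) => pt s).
rewrite !sumrB -!mulr_suml sumrB sumrB -mulr_suml (inv_sum n iq) mul1r.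
rewrite (mulr_suml _ _ _ (1 - c)^-1) (inv_sum n ip') mul1r.
by rewrite /xent; lra.
Qed.

(* If c is the largest constant with c q <= p and c < 1, the normalized
   remainder (p - c q) / (1 - c) still has bounded relative entropy, hence
   dominates a multiple of q, contradicting the choice of c. *)
Lemma bounded_relent_eq p q K B : inv_dist p -> inv_dist q -> quasi_bernoulli q K ->
  (forall n, xent n p q - xent n p p <= B) -> p = q.
Proof.
move=> ip iq bq Dle; have [q0 _ _] := bq.
have K0 : 0 < K := lt_le_trans ltr01 (quasi_bernoulli_ge1 iq bq).
pose c0 := (1 - expR (-1)) / K : R.
have c0p : 0 < c0 by rewrite divr_gt0 // subr_gt0 -[ltRHS](@expR0 R) ltr_expR ltrN10.
pose E : set R := [set c | forall s, c * q s <= p s].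
have Ec0 : E c0 by move=> s; exact: bounded_relent_minorization bq Dle.
have E1 c : E c -> c <= 1.
  by move=> /(_ [::]); rewrite (inv_nil ip) (inv_nil iq) mulr1.
have Eub : has_ubound E by exists 1.
(* The supremum is attained, since each condition [c * q s <= p s] is closed in [c]. *)
have Esup : E (sup E).
  move=> s; rewrite -ler_pdivlMr //; apply: ge_sup; first by exists c0.
  by move=> c Ec; rewrite ler_pdivlMr.
have c0le : c0 <= sup E by apply: ub_le_sup.
have sup0 : 0 < sup E := lt_le_trans c0p c0le.
have [sup1|sup1] := ltP (sup E) 1; last first.
  apply: inv_dist_le_eq => // s; apply: le_trans (Esup s).
  by rewrite ler_peMl // ltW.
have d0 : 0 < 1 - sup E by rewrite subr_gt0.
(* Adding back the part taken out turns the domination of [c0 * q] by the remainder into a multiple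
   of [q] below [p] that exceeds [sup E]. *)
have : E (sup E + c0 * (1 - sup E)).
  move=> s.
  have := bounded_relent_minorization s (inv_dist_sub ip iq sup1 Esup) iq bq.
  rewrite -/c0 => /(_ ((B - sup E * ln (sup E)) / (1 - sup E) - ln (1 - sup E))).
  rewrite /remainder ler_pdivlMr // => h.
  rewrite mulrDl -lerBrDl mulrAC; apply: h => n.
  apply: le_trans (relent_sub_le n ip iq q0 sup0 sup1 Esup) _.
  by rewrite lerD2r ler_pM2r ?invr_gt0 // lerD2r.
move=> /(ub_le_sup Eub); rewrite gerDl leNgt.
by rewrite mulr_gt0.
Qed.

Section Rates.
Variables (p q : seq A -> R) (K : R).
Hypotheses (ip : inv_dist p) (iq : inv_dist q) (bq : quasi_bernoulli q K).

(** [xent + ln K] is subadditive, so Fekete's lemma gives the limit. [xent - ln K] is superadditive,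
    and iterating this along the multiples of a fixed [n] gives the upper bound. *)
Lemma xent_rate_spec :
  (forall n, xent n p q <= n%:R * xent_rate p q + ln K) /\
  ((fun n => n%:R^-1 * xent n p q) @ \oo --> xent_rate p q).
Proof.
have K1 := quasi_bernoulli_ge1 iq bq; have lnK0 : 0 <= ln K by rewrite ln_ge0.
have x0 n : 0 <= xent n p q.
  by apply: xent_ge0 => s; [exact: inv_ge0 ip s | exact: inv_le1 iq].
have [|n|h hle hcvg] := @fekete R (fun n => xent n p q + ln K).
- by move=> n m; have := xent_almost_subadd ip iq bq n m; lra.
- by rewrite addr_ge0.
have cv : (fun n => n%:R^-1 * xent n p q) @ \oo --> h.
  rewrite [X in X @ _](_ : _ = (fun n => n%:R^-1 * (xent n p q + ln K))
      \- (fun n => n%:R^-1 * ln K)); last first.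
    by apply/funext => n /=; rewrite mulrDr addrK.
  rewrite -[h]subr0; apply: cvgB => //; rewrite -(mul0r (ln K)).
  by apply: cvgMr_tmp; exact: cvg_invn0.
have e : xent_rate p q = h by rewrite /xent_rate (cvg_lim _ cv).
rewrite e; split=> // n.
have step j : j%:R * (xent n p q - ln K) <= xent (j * n) p q - ln K + ln K.
  elim: j => [|j IH]; first by rewrite mul0r subrK.
  rewrite mulSn -natr1 mulrDl mul1r.
  by have := xent_almost_superadd ip iq bq n (j * n); lra.
have [->|n0] := posnP n.
  by rewrite /xent sum_words0 (inv_nil iq) ln1 mulr0 mul0r oppr0 add0r.
rewrite -lerBlDr mulrC -ler_pdivrMr ?ltr0n //.
have cvn : (fun j => (j.+1 * n)%:R^-1 * xent (j.+1 * n) p q) @ \oo --> h.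
  apply: (cvg_comp (fun j => (j.+1 * n)%N) (fun n => n%:R^-1 * xent n p q) _ cv).
  move=> S [N _ NS]; exists N => // j /= Nj; apply: NS => /=.
  by rewrite (leq_trans Nj) // (leq_trans (leqnSn j)) // leq_pmulr.
rewrite -(cvg_lim _ cvn) //; apply: limr_ge; first by apply/cvg_ex; exists h.
apply: nearW => j; rewrite ler_pdivrMr ?ltr0n // natrM invfM.
rewrite mulrAC divfK ?pnatr_eq0 -?lt0n //.
rewrite ler_pdivlMl ?ltr0n //.
by have := step j.+1; rewrite subrK.
Qed.

Lemma entropy_rate_le : xent_rate p p <= xent_rate p q.
Proof.
have [_ c1] := entropy_rate_spec ip; have [_ c2] := xent_rate_spec.
rewrite -(cvg_lim _ c1) // -(cvg_lim _ c2) //; apply: ler_lim.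
- by apply/cvg_ex; eexists; exact: c1.
- by apply/cvg_ex; eexists; exact: c2.
- apply: nearW => n; rewrite ler_wpM2l ?invr_ge0 //.
  by apply: xent_self_le => //; case: bq.
Qed.

Lemma entropy_rate_eq : xent_rate p p = xent_rate p q -> p = q.
Proof.
move=> e; apply: (bounded_relent_eq (B := ln K) ip iq bq) => n.
have := (entropy_rate_spec ip).1 n; have := xent_rate_spec.1 n.
by rewrite e; lra.
Qed.

End Rates.

End VariationalUniqueness.

(** * Cylinders, their masses and functions of finitely many letters *)

(** Finite additivity over the values of [f], listed by [r]; it serves words, single letters and
    itineraries alike. *)
Lemma fine_measure_fibers d (T : measurableType d) (R : realType)
    (m : probability T R) (J : choiceType) (f : T -> J) (r : seq J) (D : set T) :
  uniq r -> (forall x, D x -> f x \in r) -> measurable D ->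
  (forall j, measurable (f @^-1` [set j])) ->
  fine (m D) = \sum_(j <- r) fine (m (D `&` f @^-1` [set j])).
Proof.
move=> ur fr mD mf.
have DE : D = \bigcup_(j in [set` r]) (D `&` f @^-1` [set j]).
  apply/seteqP; split=> x; first by move=> Dx; exists (f x) => //; exact: fr.
  by case=> j _ [].
rewrite {1}DE measure_fin_bigcup //; first last.
- by move=> j _; exact: measurableI.
- by move=> i j _ _ [x [[_ <-] [_ <-]]].
rewrite -fsbig_seq // -sum_fine // => j _.
exact: fin_num_measure (measurableI _ _ mD (mf j)).
Qed.

Section Blocks.
Variable k : nat.
Implicit Types (x : Shift k) (w : seq 'I_k.+1).

Definition block n x : seq 'I_k.+1 := mkseq x n.

Definition extend w : Shift k := fun i => nth ord0 w i.

(** Cylinders are indexed by words instead of points, so that masses become functions on [seq]. *)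
Definition wcyl w : set (Shift k) := [set x | block (size w) x = w].

(** Finite unions of cylinders of length [n]. They generate the sigma-algebra and are closed under
    intersection, which suits Dynkin arguments. *)
Definition bset n (P : pred (seq 'I_k.+1)) : set (Shift k) :=
  [set x | P (block n x)].

Lemma size_block n x : size (block n x) = n.
Proof. exact: size_mkseq. Qed.

Lemma nth_block n x i : (i < n)%N -> nth ord0 (block n x) i = x i.
Proof. exact: nth_mkseq. Qed.

Lemma block_words n x : block n x \in words _ n.
Proof. by rewrite mem_words size_block. Qed.

Lemma blockP n x x' : block n x = block n x' <-> (forall i, (i < n)%N -> x i = x' i).
Proof.
split=> [e i ni|e]; first by rewrite -(nth_block x ni) e nth_block.
apply: (@eq_from_nth _ ord0); rewrite !size_block // => i ni.
by rewrite !nth_block // e.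
Qed.

Lemma block_extend w : block (size w) (extend w) = w.
Proof.
apply: (@eq_from_nth _ ord0); rewrite !size_block // => i ni.
by rewrite !nth_block.
Qed.

Lemma take_block n m x : (n <= m)%N -> take n (block m x) = block n x.
Proof. by move=> nm; rewrite /block /mkseq -map_take take_iota (minn_idPl nm). Qed.

Lemma iter_shift n x i : iter n (@shift k) x i = x (n + i)%N.
Proof. by elim: n i => [|n IH] i //=; rewrite /shift IH addSnnS. Qed.

Lemma block_cat n m x : block (n + m) x = block n x ++ block m (iter n (@shift k) x).
Proof.
rewrite /block /mkseq iotaD map_cat add0n; congr (_ ++ _).
rewrite -[n in iota n]addn0 iotaDl -map_comp; apply: eq_map => i /=.
by rewrite iter_shift.
Qed.

Lemma blockS n x : block n.+1 x = x 0%N :: block n (shift x).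
Proof. exact: (block_cat 1 n x). Qed.

Lemma block_rcons n x : block n.+1 x = rcons (block n x) (x n).
Proof. by rewrite /block /mkseq -(addn1 n) iotaD map_cat cats1. Qed.

Lemma cyl_wcyl n x : cyl n x = wcyl (block n x).
Proof.
by apply/seteqP; split=> x' /=; rewrite /wcyl /= size_block blockP.
Qed.

Lemma wcyl_cyl w : wcyl w = cyl (size w) (extend w).
Proof. by rewrite cyl_wcyl block_extend. Qed.

Lemma measurable_wcyl w : measurable (wcyl w).
Proof. by apply: sub_sigma_algebra; exists (size w), (extend w); rewrite wcyl_cyl. Qed.

Lemma bset_bigcup n P : bset n P = \bigcup_(w in [set` [seq w <- words _ n | P w]]) wcyl w.
Proof.
apply/seteqP; split=> x.
  move=> Px; exists (block n x); last by rewrite /wcyl /= size_block.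
  by rewrite /= mem_filter block_words andbT.
by case=> w /=; rewrite mem_filter mem_words /bset /wcyl /= => /andP[Pw /eqP <-] ->.
Qed.

Lemma measurable_bset n P : measurable (bset n P).
Proof.
rewrite bset_bigcup; apply: fin_bigcup_measurable; first exact: finite_seq.
by move=> w _; exact: measurable_wcyl.
Qed.

Lemma measurable_block_fiber n w : measurable (block n @^-1` [set w]).
Proof.
rewrite (_ : _ @^-1` _ = bset n (pred1 w)); first exact: measurable_bset.
by apply/seteqP; split=> x /eqP.
Qed.

Lemma bset_widen n m P : (n <= m)%N -> bset n P = bset m (fun w => P (take n w)).
Proof. by move=> nm; apply/seteqP; split=> x; rewrite /bset /= take_block. Qed.

Lemma bset_setI n m P Q :
  bset n P `&` bset m Q
  = bset (maxn n m) (fun w => P (take n w) && Q (take m w)).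
Proof.
rewrite (bset_widen P (leq_maxl n m)) (bset_widen Q (leq_maxr n m)).
by apply/seteqP; split=> x; rewrite /bset /= => /andP.
Qed.

Definition bsets : set (set (Shift k)) := [set B | exists n P, B = bset n P].

Lemma measurable_bsets : @measurable _ (Shift k) = <<s bsets >>.
Proof.
apply/seteqP; split; last first.
  apply: smallest_sub; first exact: sigma_algebra_measurable.
  by move=> _ [n [P ->]]; exact: measurable_bset.
apply: smallest_sub; first exact: smallest_sigma_algebra.
move=> _ [n [x ->]]; apply: sub_sigma_algebra; exists n, (pred1 (block n x)).
by rewrite cyl_wcyl; apply/seteqP; split=> x'; rewrite /wcyl /bset /= size_block => /eqP.
Qed.

Lemma bsets_setI : setI_closed bsets.
Proof.
by move=> _ _ [n [P ->]] [m [Q ->]]; rewrite bset_setI; do 2!eexists; reflexivity.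
Qed.

Lemma measurable_shift : measurable_fun setT (@shift k).
Proof.
apply: (measurability _ measurable_bsets) => _ [_ [n [P ->]] <-].
rewrite setTI (_ : _ @^-1` _ = bset n.+1 (P \o behead)).
  exact: measurable_bset.
have e x : behead (block n.+1 x) = block n (shift x) by rewrite blockS.
by apply/funext => x; rewrite /bset /preimage /mkset /comp e.
Qed.

Lemma measurable_iter_shift i : measurable_fun setT (iter i (@shift k)).
Proof.
elim: i => [|i IH]; first exact: measurable_id.
exact: measurableT_comp measurable_shift IH.
Qed.

Section Mass.
Variables (R : realType) (m : probability (Shift k) R).

Definition mass w : R := fine (m (wcyl w)).

Lemma fine_measure_blocks D n : measurable D ->
  fine (m D) = \sum_(w <- words _ n) fine (m (D `&` block n @^-1` [set w])).
Proof.
move=> mD; apply: fine_measure_fibers => //; first exact: words_uniq.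
  by move=> x _; exact: block_words.
by move=> w; exact: measurable_block_fiber.
Qed.

Lemma wcyl_preimage n w : size w = n -> block n @^-1` [set w] = wcyl w.
Proof. by move=> <-. Qed.

Lemma fine_measure_bset n P : fine (m (bset n P)) = \sum_(w <- words _ n | P w) mass w.
Proof.
rewrite (@fine_measure_fibers _ _ R m _ (block n) [seq w <- words _ n | P w]).
- rewrite big_filter [LHS]big_seq_cond [RHS]big_seq_cond.
  apply: eq_bigr => w /andP[]; rewrite mem_words => /eqP wn Pw.
  rewrite /mass -(wcyl_preimage wn) setIidr // => x /= xw.
  by rewrite /bset /= xw.
- by rewrite filter_uniq // words_uniq.
- by move=> x Px; rewrite mem_filter block_words andbT.
- exact: measurable_bset.
- by move=> w; exact: measurable_block_fiber.
Qed.

Lemma massE w : (mass w)%:E = m (wcyl w).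
Proof. by rewrite fineK // fin_num_measure //; exact: measurable_wcyl. Qed.

(** Splitting by the letter after [s] gives [inv_rcons]; for [inv_cons] the shift preimage of the
    cylinder is split by its first letter. *)
Lemma mass_inv_dist : shift_invariant m -> inv_dist mass.
Proof.
move=> minv; split=> [s||s|s].
- exact: fine_ge0.
- by rewrite /mass (_ : wcyl [::] = setT) ?probability_setT //; apply/seteqP.
- rewrite [RHS](@fine_measure_fibers _ _ R m _ (fun x => x (size s)) (enum 'I_k.+1)).
  + rewrite big_enum; apply: eq_bigr => a _; congr (fine (m _)).
    apply/seteqP; split=> x; rewrite /wcyl /= size_rcons block_rcons.
      by move=> /eqP; rewrite eqseq_rcons => /andP[/eqP-> /eqP->].
    by case=> -> ->.
  + by rewrite enum_uniq.
  + by move=> x _; rewrite mem_enum.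
  + exact: measurable_wcyl.
  + move=> a; rewrite (_ : _ @^-1` _ = bset (size s).+1 (fun w => nth ord0 w (size s) == a)).
      exact: measurable_bset.
    by apply/seteqP; split=> x; rewrite /bset /= nth_block // => /eqP.
- have ms : measurable (@shift k @^-1` wcyl s).
    by rewrite -[X in measurable X]setTI; apply: measurable_shift => //; exact: measurable_wcyl.
  rewrite [RHS]/mass -minv; last exact: measurable_wcyl.
  rewrite [RHS](@fine_measure_fibers _ _ R m _ (fun x => x 0%N) (enum 'I_k.+1)) //.
  + rewrite big_enum; apply: eq_bigr => a _; congr (fine (m _)).
    apply/seteqP; split=> x; rewrite /wcyl /setI /preimage /mkset [size (_ :: _)]/= blockS.
      by case=> -> ->.
    by case=> -> ->.
  + by rewrite enum_uniq.
  + by move=> x _; rewrite mem_enum.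
  + move=> a; rewrite (_ : _ @^-1` _ = bset 1 (fun w => nth ord0 w 0 == a)).
      exact: measurable_bset.
    by apply/seteqP; split=> x; rewrite /bset /= => /eqP.
Qed.

Lemma block_indic n (F : seq 'I_k.+1 -> R) x :
  F (block n x) = \sum_(w <- words _ n) F w * \1_(block n @^-1` [set w]) x.
Proof.
rewrite (bigD1_seq (block n x)) ?block_words ?words_uniq //= big1 ?addr0.
  by rewrite indicE mem_set // mulr1.
by move=> w wx; rewrite indicE memNset ?mulr0 //= => xw; rewrite xw eqxx in wx.
Qed.

Lemma measurable_block n (F : seq 'I_k.+1 -> R) :
  measurable_fun setT (fun x => F (block n x)).
Proof.
apply: (eq_measurable_fun (fun x => \sum_(w <- words _ n) F w * \1_(block n @^-1` [set w]) x)).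
  by move=> x _; rewrite -block_indic.
apply: measurable_sum => w; apply: measurable_funM => //.
exact: measurable_indic (measurable_block_fiber n w).
Qed.

Lemma integrable_block n (F : seq 'I_k.+1 -> R) :
  m.-integrable setT (fun x => (F (block n x))%:E).
Proof.
apply: (eq_integrable _ (fun x => \sum_(w <- words _ n) (F w)%:E * (\1_(block n @^-1` [set w]) x)%:E)%E) => //.
  by move=> x _; rewrite block_indic -sumEFin.
apply: integrable_sum => // w _.
apply: integrableZl => //; exact: (integrable_indic m (measurable_block_fiber n w)).
Qed.

Lemma integral_block n (F : seq 'I_k.+1 -> R) :
  (\int[m]_x (F (block n x))%:E)%E = (\sum_(w <- words _ n) mass w * F w)%:E.
Proof.
rewrite (eq_integral (fun x => \sum_(w <- words _ n) (F w)%:E * (\1_(block n @^-1` [set w]) x)%:E)%E); last first.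
  by move=> x _; rewrite block_indic -sumEFin.
rewrite integral_sum //; last first.
  move=> w; apply: integrableZl => //; exact: (integrable_indic m (measurable_block_fiber n w)).
rewrite -sumEFin big_seq [RHS]big_seq; apply: eq_bigr => w.
rewrite mem_words => /eqP wn.
rewrite integralZl //; last exact: integrable_indic (measurable_block_fiber n w).
rewrite integral_indic //; last exact: measurable_block_fiber.
by rewrite setIT (wcyl_preimage wn) EFinM massE muleC.
Qed.

End Mass.

Lemma mass_same_measure (R : realType) (m1 m2 : probability (Shift k) R) :
  mass m1 = mass m2 -> same_measure m1 m2.
Proof.
move=> e A mA; apply: (measure_unique bsets (fun=> setT)) => //.
- exact: measurable_bsets.
- exact: bsets_setI.
- by move=> _; exists 0%N, xpredT; apply/seteqP.
- by rewrite bigcup_const //; exists 0%N.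
- move=> _ [n [P ->]].
  rewrite -[LHS]fineK ?fin_num_measure //; last exact: measurable_bset.
  rewrite -[RHS]fineK ?fin_num_measure //; last exact: measurable_bset.
  by rewrite !fine_measure_bset e.
- by move=> _; rewrite -ge0_fin_numE // fin_num_measure.
Qed.

End Blocks.

(** * Approximation of measurable partitions by cylinders *)

Section FineMeasure.
Context d (T : measurableType d) (R : realType) (m : probability T R).
Implicit Types A B C : set T.

Lemma fine_measure_le A B : measurable A -> measurable B -> A `<=` B ->
  fine (m A) <= fine (m B).
Proof.
move=> mA mB AB; apply: fine_le; rewrite ?fin_num_measure //.
by apply: le_measure => //; rewrite inE.
Qed.

Lemma fine_measureU A B : measurable A -> measurable B ->
  fine (m (A `|` B)) <= fine (m A) + fine (m B).
Proof.
move=> mA mB; rewrite -fineD ?fin_num_measure //.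
apply: fine_le; rewrite ?fin_numD ?fin_num_measure //; first exact: measurableU.
exact: measureU2.
Qed.

Lemma measurable_setY A B : measurable A -> measurable B -> measurable (A `+` B).
Proof. by move=> mA mB; apply: measurableU; exact: measurableD. Qed.

End FineMeasure.

Section Approximation.
Variables (k : nat) (R : realType) (m : probability (Shift k) R).

Let approx (B : set (Shift k)) := forall e : R, 0 < e ->
  exists n P, fine (m (B `+` bset n P)) <= e.

Let approxU A B : measurable A -> measurable B -> approx A -> approx B -> approx (A `|` B).
Proof.
move=> mA mB aA aB e e0; have e20 : 0 < e / 2 by rewrite divr_gt0.
have [n [P h]] := aA _ e20; have [n' [Q h']] := aB _ e20.
have mP := @measurable_bset k n P; have mQ := @measurable_bset k n' Q.
exists (maxn n n'), (fun w => P (take n w) || Q (take n' w)).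
rewrite (_ : bset _ _ = bset n P `|` bset n' Q); last first.
  rewrite (bset_widen P (leq_maxl n n')) (bset_widen Q (leq_maxr n n')).
  by apply/seteqP; split=> x; rewrite /bset /= => /orP.
have mY := measurable_setY mA mP; have mY' := measurable_setY mB mQ.
apply: (@le_trans _ _ (fine (m ((A `+` bset n P) `|` (B `+` bset n' Q))))).
  apply: fine_measure_le; first by apply: measurable_setY; exact: measurableU.
    exact: measurableU.
  by move=> x /=; tauto.
by apply: (le_trans (fine_measureU _ mY mY')); rewrite [leRHS]splitr lerD.
Qed.

(** Dynkin induction: approximability passes to complements and to countable unions, the latter
    because the tail beyond a finite union has small measure. *)
Lemma bset_approx B : measurable B -> forall e : R, 0 < e ->
  exists n P, fine (m (B `+` bset n P)) <= e.
Proof.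
move=> mB; change (approx B); have := mB; rewrite measurable_bsets.
apply: (dynkin_induction (G := @bsets k)).
- exact: measurable_bsets.
- exact: bsets_setI.
- move=> e e0; exists 0%N, xpredT.
  rewrite (_ : bset _ _ = setT); last by apply/seteqP.
  by rewrite setYK measure0 ltW.
- move=> _ [n [P ->]] e e0; exists n, P.
  by rewrite setYK measure0 ltW.
- move=> S mS aS e e0; have [n [P h]] := aS e e0; exists n, (predC P).
  have -> : bset n (predC P) = ~` bset n P by apply/seteqP; split=> x /negP.
  rewrite (_ : _ `+` _ = S `+` bset n P) //.
  apply/seteqP; split=> x /=;
    by have [?|?] := pselect (S x); have [?|?] := pselect (bset n P x); tauto.
- move=> F mF _ aF e e0; have e20 : 0 < e / 2 by rewrite divr_gt0.
  pose U n := \big[setU/set0]_(i < n) F i.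
  have mU n : measurable (U n) by apply: bigsetU_measurable.
  have mbF : measurable (\bigcup_i F i) by exact: bigcupT_measurable.
  pose tail n := \bigcup_i F i `\` U n.
  have mtail n : measurable (tail n) by exact: measurableD.
  have aU n : approx (U n).
    elim: n => [|n IH].
      move=> r r0; exists 0%N, xpred0; rewrite /U big_ord0.
      rewrite (_ : bset _ _ = set0); last by apply/seteqP; split=> x.
      by rewrite setYK measure0 ltW.
    by rewrite /U big_ord_recr; exact: approxU (mU n) (mF n) IH (aF n).
  have tail0 : \bigcap_n tail n = set0.
    apply/seteqP; split=> x // xt; have [[i _ Fi] _] := xt 0%N I.
    have [_] := xt i.+1 I; apply.
    by rewrite /U -bigcup_mkord; exists i => /=.
  have : (m \o tail) @ \oo --> m set0.
    rewrite -tail0; apply: nonincreasing_cvg_mu => //.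
    - by rewrite -ge0_fin_numE // fin_num_measure.
    - by rewrite tail0.
    - move=> n n' nn'; apply/subsetPset => x [Fx Ux]; split=> // Ux'; apply: Ux.
      move: Ux'; rewrite /U -!bigcup_mkord => -[i /= ni Fi].
      by exists i => //=; exact: leq_trans ni nn'.
  rewrite measure0 => /fine_cvg /cvgrPdist_le /(_ _ e20) [n _ /(_ n (leqnn n))].
  rewrite /= sub0r normrN ger0_norm ?fine_ge0 // => tn.
  have [N [P h]] := aU n _ e20; exists N, P.
  have mY := measurable_setY (mU n) (measurable_bset N P).
  apply: (@le_trans _ _ (fine (m (tail n `|` (U n `+` bset N P))))).
    apply: fine_measure_le; first by apply: measurable_setY => //; exact: measurable_bset.
      exact: measurableU.
    have UF : U n `<=` \bigcup_i F i.
      by rewrite /U -bigcup_mkord => x [i _ Fi]; exists i.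
    move=> x [[Fx nP]|[Px nF]].
      by have [Ux|Ux] := pselect (U n x); [right; left|left].
    by right; right; split=> // /UF.
  by apply: (le_trans (fine_measureU _ (mtail n) mY)); rewrite [leRHS]splitr lerD.
Qed.

Lemma measurable_mismatch M (alpha : Shift k -> 'I_M) n (beta : seq 'I_k.+1 -> 'I_M) :
  (forall i, measurable (alpha @^-1` [set i])) ->
  measurable [set x | alpha x != beta (block n x)].
Proof.
move=> ma; rewrite (_ : [set x | _] = \bigcup_(i in [set: 'I_M]) (alpha @^-1` [set i] `&`
    bset n (fun w => i != beta w))).
  apply: fin_bigcup_measurable; first exact: finite_finset.
  by move=> i _; apply: measurableI => //; exact: measurable_bset.
apply/seteqP; split=> x; first by move=> Dx; exists (alpha x).
by move=> [i _ [/= <-]].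
Qed.

Lemma partition_approx M (alpha : Shift k -> 'I_M.+1) :
  (forall i, measurable (alpha @^-1` [set i])) -> forall e : R, 0 < e ->
  exists n (beta : seq 'I_k.+1 -> 'I_M.+1),
    fine (m [set x | alpha x != beta (block n x)]) <= e.
Proof.
move=> ma e e0; pose e' := e / M.+1%:R; have e'0 : 0 < e' by rewrite divr_gt0.
have /choice[f fP] : forall i, exists nP : nat * pred (seq 'I_k.+1),
    fine (m (alpha @^-1` [set i] `+` bset nP.1 nP.2)) <= e'.
  by move=> i; have [n [P h]] := bset_approx (ma i) e'0; exists (n, P).
pose N := \max_i (f i).1.
pose Q i w := (f i).2 (take (f i).1 w).
have QP i : bset (f i).1 (f i).2 = bset N (Q i).
  by apply: bset_widen; rewrite /N (bigD1 i) //= leq_maxl.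
(* The label read from a block is some [i] whose approximating set contains it, or [ord0] if there
   is none. A mismatch then puts [x] into one of the [M.+1] symmetric differences. *)
exists N, (fun w => odflt ord0 [pick i | Q i w]).
set D := [set x | _]; pose E i := alpha @^-1` [set i] `+` bset N (Q i).
have mE i : measurable (E i) by apply: measurable_setY => //; exact: measurable_bset.
have mEu (r : seq 'I_M.+1) : measurable (\big[setU/set0]_(i <- r) E i).
  exact: bigsetU_measurable.
have DE : D `<=` \big[setU/set0]_(i <- enum 'I_M.+1) E i.
  move=> x; rewrite /D /= => ne; rewrite -bigcup_seq /=.
  move: ne; case: pickP => [i Qi|noQ] /= ne.
    exists i; first by rewrite /= mem_enum.
    by right; split=> //= ai; rewrite ai eqxx in ne.
  exists (alpha x); first by rewrite /= mem_enum.
  by left; split=> //; rewrite /bset /= noQ.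
have mD : measurable D.
  exact: (measurable_mismatch N (fun w => odflt ord0 [pick i | Q i w])).
apply: le_trans (fine_measure_le _ mD (mEu _) DE) _.
have bound (r : seq 'I_M.+1) : fine (m (\big[setU/set0]_(i <- r) E i)) <= (size r)%:R * e'.
  elim: r => [|i r IH]; first by rewrite big_nil measure0 mul0r.
  rewrite big_cons; apply: (le_trans (fine_measureU _ (mE i) (mEu r))).
  by rewrite /= -natr1 mulrDl mul1r addrC lerD // /E -QP.
apply: (le_trans (bound _)).
by rewrite size_enum_ord /e' mulrC divfK // pnatr_eq0.
Qed.

End Approximation.

(** * Kolmogorov-Sinai entropy as the entropy rate of cylinder masses *)

Lemma ln_prod (R : realType) (I : Type) (r : seq I) (F : I -> R) :
  (forall i, 0 < F i) -> ln (\prod_(i <- r) F i) = \sum_(i <- r) ln (F i).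
Proof.
move=> F0; elim: r => [|i r IH]; first by rewrite !big_nil ln1.
by rewrite !big_cons lnM ?posrE ?IH // prodr_gt0.
Qed.

(** [join_entropy] indexes itineraries by finite functions, entropies of words by lists; this
    identifies the two sums. *)
Lemma sum_ffun_words (R : realType) (A : finType) n (F : seq A -> R) :
  \sum_(w : {ffun 'I_n -> A}) F (codom w) = \sum_(v <- words A n) F v.
Proof.
rewrite -big_enum -(big_map (fun w : {ffun 'I_n -> A} => codom w) xpredT F) /=.
apply: perm_big; apply: uniq_perm; last move=> v.
- rewrite map_inj_uniq ?enum_uniq // => f g fg; apply/ffunP => i.
  have /(congr1 (fun s => nth (f i) s (enum_rank i))) := fg.
  by rewrite !nth_codom enum_rankK.
- exact: words_uniq.
- rewrite mem_words; apply/mapP/eqP => [[f _ ->]|vn].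
    by rewrite size_codom card_ord.
  move/eqP: vn => vn; exists [ffun i => tnth (Tuple vn) i]; first by rewrite mem_enum.
  rewrite -[LHS]/(tval (Tuple vn)) -[LHS]map_tnth_enum /codom /image_mem.
  by apply: eq_map => i; rewrite ffunE.
Qed.

Section KolmogorovSinai.
Variables (k : nat) (R : realType) (m : probability (Shift k) R).
Hypothesis m_inv : shift_invariant m.

Let ip := mass_inv_dist m_inv.

Definition coord_partition (a : 'I_k.+1) : set (Shift k) := [set x | x 0%N = a].

Lemma meas_coord_partition : meas_partition coord_partition.
Proof.
split=> [a|]; last split.
- rewrite (_ : coord_partition a = bset 1 (fun w => nth ord0 w 0 == a)).
    exact: measurable_bset.
  by apply/seteqP; split=> x; rewrite /bset /coord_partition /= => /eqP.
- move=> a b ab; apply/seteqP; split=> x //= [xa xb].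
  by move: ab; rewrite -xa -xb eqxx.
- by apply/seteqP; split=> x // _; exists (x 0%N).
Qed.

Lemma join_entropy_coord n : join_entropy m coord_partition n = xent n (mass m) (mass m).
Proof.
rewrite /join_entropy /xent -sumrN -sum_ffun_words; apply: eq_bigr => w _ /=.
set C := \bigcap_(_ in _) _.
suff -> : C = wcyl (codom w) by [].
have nw (i : 'I_n) : nth ord0 (codom w) i = w i.
  by rewrite -[in RHS](enum_rankK i) -(nth_codom ord0) enum_rank_ord.
apply/seteqP; split=> x; rewrite /wcyl /= size_codom card_ord.
  move=> Cx; apply: (@eq_from_nth _ ord0); rewrite size_block ?size_codom ?card_ord // => i ni.
  rewrite nth_block // (nw (Ordinal ni)).
  by have := Cx (Ordinal ni) I; rewrite /= /coord_partition /= iter_shift addn0.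
move=> xw i _; rewrite /= /coord_partition /= iter_shift addn0.
by rewrite -(nth_block x (ltn_ord i)) xw nw.
Qed.

Lemma part_entropy_coord : part_entropy m coord_partition = xent_rate (mass m) (mass m).
Proof.
by rewrite /part_entropy; under eq_fun do rewrite join_entropy_coord.
Qed.

Lemma fine_measure_iter_shift i (B : set (Shift k)) : measurable B ->
  m (iter i (@shift k) @^-1` B) = m B.
Proof.
move=> mB; elim: i => [|i IH] //.
rewrite (_ : _ @^-1` _ = @shift k @^-1` (iter i (@shift k) @^-1` B)).
  rewrite m_inv ?IH // -[X in measurable X]setTI.
  exact: measurable_iter_shift.
by apply/funext => x; rewrite /preimage /mkset iterSr.
Qed.

Section Partition.
Variables (M : nat) (alpha : Shift k -> 'I_M.+1).
Hypothesis ma : forall i, measurable (alpha @^-1` [set i]).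

Let cells i := alpha @^-1` [set i].

Let itin n (x : Shift k) : {ffun 'I_n -> 'I_M.+1} :=
  [ffun i : 'I_n => alpha (iter i (@shift k) x)].

Let cellE n (a : {ffun 'I_n -> 'I_M.+1}) :
  \bigcap_(i in [set: 'I_n]) (iter i (@shift k) @^-1` cells (a i)) = itin n @^-1` [set a].
Proof.
apply/seteqP; split=> x.
  by move=> h; apply/ffunP => i; rewrite ffunE; exact: h i I.
by move=> /= <- i _; rewrite /cells /= ffunE.
Qed.

Let measurable_iter_preimage i (B : set (Shift k)) : measurable B ->
  measurable (iter i (@shift k) @^-1` B).
Proof. by move=> mB; rewrite -[X in measurable X]setTI; exact: measurable_iter_shift. Qed.

Let mitin n a : measurable (itin n @^-1` [set a]).
Proof.
rewrite -cellE; apply: fin_bigcap_measurable; first exact: finite_finset.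
by move=> i _; exact: measurable_iter_preimage (ma (a i)).
Qed.

(* Gibbs' inequality against the law Q of a word w chosen by m together with an
   itinerary that at each time follows beta, a deviation having weight e^-t. *)
Lemma join_entropy_le n N (beta : seq 'I_k.+1 -> 'I_M.+1) (t eta : R) : 0 <= t ->
  fine (m [set x | alpha x != beta (block N x)]) <= eta ->
  join_entropy m cells n <=
    xent (n + N) (mass m) (mass m) + n%:R * (t * eta + M.+1%:R * expR (- t)).
Proof.
(* Length [n + N] makes the window of length [N] visible at every time below [n]. *)
move=> t0 eta_ge; set L := (n + N)%N; set p := mass m.
pose r (a : {ffun 'I_n -> 'I_M.+1}) w : R :=
  fine (m (itin n @^-1` [set a] `&` block L @^-1` [set w])).
have r0 a w : 0 <= r a w by exact: fine_ge0.
have mr a w : measurable (itin n @^-1` [set a] `&` block L @^-1` [set w]).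
  by apply: measurableI => //; exact: measurable_block_fiber.
have ra a : fine (m (itin n @^-1` [set a])) = \sum_(w <- words _ L) r a w.
  exact: fine_measure_blocks.
have rw w : size w = L -> p w = \sum_a r a w.
  move=> wL; rewrite /p /mass -(wcyl_preimage wL).
  rewrite (@fine_measure_fibers _ _ R m _ (itin n) (enum {ffun 'I_n -> 'I_M.+1})) ?enum_uniq //.
  - by rewrite big_enum; apply: eq_bigr => a _; rewrite /r setIC.
  - by move=> x _; rewrite mem_enum.
  - exact: measurable_block_fiber.
  - by move=> a; exact: mitin.
pose b (w : seq 'I_k.+1) (i : 'I_n) := beta (take N (drop i w)).
pose g (u : bool) : R := if u then 1 else expR (- t).
have g0 u : 0 < g u by rewrite /g; case: u; rewrite ?expR_gt0.
(* [Z] bounds the total weight of the [M.+1] labels at one time, so that [Q] sums to at most [p w]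
   over the itineraries. *)
pose Z : R := 1 + M.+1%:R * expR (- t).
have Z0 : 0 < Z by rewrite /Z ltr_wpDr // mulr_ge0 // expR_ge0.
pose Q (a : {ffun 'I_n -> 'I_M.+1}) w : R := p w * \prod_i (g (a i == b w i) / Z).
have Q0 a w : 0 <= Q a w.
  rewrite mulr_ge0 ?(inv_ge0 ip) // prodr_ge0 // => i _.
  by rewrite divr_ge0 // ltW.
have prod0 a w : 0 < \prod_i (g (a i == b w i) / Z) :> R.
  by apply: prodr_gt0 => i _; rewrite divr_gt0.
have rp a w : size w = L -> r a w <= p w.
  by move=> wL; rewrite (rw w wL) (bigD1 a) //= lerDl sumr_ge0.
have sumQ w : \sum_a Q a w <= p w.
  rewrite -mulr_sumr ler_piMr ?(inv_ge0 ip) //.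
  rewrite -(bigA_distr_bigA (fun i j => g (j == b w i) / Z)).
  apply: prodr_ile1 => i _; apply/andP; split.
    by apply: sumr_ge0 => j _; rewrite divr_ge0 // ltW.
  rewrite -mulr_suml ler_pdivrMr // mul1r (bigD1 (b w i)) //= eqxx /Z lerD2l.
  rewrite (eq_bigr (fun=> expR (- t))); last by move=> j /negbTE ->.
  rewrite sumr_const mulr_natl ler_wpMn2l ?expR_ge0 //.
  by rewrite (leq_trans (max_card _)) // card_ord.
(* Splitting cells by words only increases the entropy, each piece having at most the mass of its
   cell. *)
have step1 : join_entropy m cells n <= - \sum_a \sum_(w <- words _ L) r a w * ln (r a w).
  rewrite /join_entropy sumrN lerN2; apply: ler_sum => a _ /=.
  rewrite cellE ra mulr_suml; apply: ler_sum => w _.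
  have [->|rn0] := eqVneq (r a w) 0; first by rewrite !mul0r.
  have rp0 : 0 < r a w by rewrite lt0r rn0 r0.
  have rle : r a w <= fine (m (itin n @^-1` [set a])).
    by apply: fine_measure_le => //; exact: subIsetl.
  by rewrite ler_wpM2l // -ra ler_ln ?posrE // (lt_le_trans rp0).
pose c a w (i : 'I_n) : R := (a i != b w i)%:R.
have lnZ : ln Z <= M.+1%:R * expR (- t).
  by apply: le_ln1Dx; rewrite (lt_le_trans (ltrN10 R)) // mulr_ge0 // expR_ge0.
have pt a w : size w = L -> - (r a w * ln (r a w)) <=
    - (r a w * ln (p w)) + \sum_i (t * (r a w * c a w i) + r a w * (M.+1%:R * expR (- t)))
    + (Q a w - r a w).
  move=> wL; have [pw0|pwn0] := eqVneq (p w) 0.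
    have ra0 : r a w = 0 by apply/eqP; rewrite eq_le r0 andbT -pw0 rp.
    by rewrite /Q pw0 ra0 big1 ?(mul0r, subr0, addr0, oppr0) // => i _; rewrite !mul0r mulr0 addr0.
  have pw : 0 < p w by rewrite lt0r pwn0 (inv_ge0 ip).
  have Qp : 0 < Q a w by rewrite mulr_gt0.
  have Qr : Q a w = 0 -> r a w = 0 by move=> h; move: Qp; rewrite h ltxx.
  have := gibbs_pointwise (r0 a w) (Q0 a w) Qr ltr01; rewrite ln1 addr0 mulr1 mul1r.
  rewrite {2}/Q lnM ?posrE // ln_prod; last by move=> i; rewrite divr_gt0.
  move=> h; have : - (r a w * \sum_i ln (g (a i == b w i) / Z)) <=
     \sum_i (t * (r a w * c a w i) + r a w * (M.+1%:R * expR (- t))).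
    rewrite mulr_sumr -sumrN; apply: ler_sum => i _.
    rewrite ln_div ?posrE // -mulrN opprB mulrCA -mulrDr ler_wpM2l //.
    rewrite addrC lerD // /g /c; case: eqP => _ /=.
      by rewrite ln1 oppr0 mulr0.
    by rewrite expRK opprK mulr1.
  by rewrite mulrDr in h; lra.
(* By invariance a mismatch at time [i] is as likely as one at time 0. *)
have step2 i : \sum_a \sum_(w <- words _ L) r a w * c a w i <= eta.
  apply: le_trans eta_ge; set D0 := [set x | _].
  have mD0 : measurable D0 := measurable_mismatch N beta ma.
  rewrite -(fine_measure_iter_shift i mD0).
  set D := _ @^-1` D0; have mD : measurable D by exact: measurable_iter_preimage.
  rewrite (@fine_measure_fibers _ _ R m _ (itin n) (enum {ffun 'I_n -> 'I_M.+1}))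
    ?enum_uniq //; first last.
  - by move=> a; exact: mitin.
  - by move=> x _; rewrite mem_enum.
  rewrite big_enum /=; apply: ler_sum => a _.
  have mDa : measurable (D `&` itin n @^-1` [set a]) by exact: measurableI.
  rewrite (fine_measure_blocks m L mDa) big_seq [leRHS]big_seq; apply: ler_sum => w.
  rewrite mem_words => /eqP wL; rewrite /c; have [_|ne] := eqVneq (a i) (b w i).
    by rewrite mulr0 fine_ge0.
  rewrite mulr1; apply: fine_measure_le => //.
    by apply: measurableI => //; exact: measurable_block_fiber.
  move=> x [/= xa xw]; split=> //; split=> //.
  rewrite /D /D0 /=; move: ne; rewrite -xa ffunE; apply: contra_neq => ->.
  have Li : (n + N = i + (n - i + N))%N by rewrite addnA subnKC // ltnW.
  congr beta; rewrite /b -xw /L Li block_cat drop_size_cat ?size_block //.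
  by rewrite take_block // leq_addl.
apply: (le_trans step1).
have sumr_w (G : seq 'I_k.+1 -> R) : \sum_a \sum_(w <- words _ L) r a w * G w
    = \sum_(w <- words _ L) p w * G w.
  rewrite exchange_big /= big_seq [RHS]big_seq; apply: eq_bigr => w.
  by rewrite mem_words => /eqP wL; rewrite (rw w wL) mulr_suml.
have sumr1 : \sum_a \sum_(w <- words _ L) r a w = 1.
  rewrite -(inv_sum L ip) -[RHS](eq_bigr _ (fun w _ => mulr1 (mass m w))) -(sumr_w (fun=> 1)).
  by do 2!apply: eq_bigr => ? _; rewrite mulr1.
have bound : - \sum_a \sum_(w <- words _ L) r a w * ln (r a w) <=
  \sum_a \sum_(w <- words _ L) (- (r a w * ln (p w)) +
   \sum_i (t * (r a w * c a w i) + r a w * (M.+1%:R * expR (- t))) + (Q a w - r a w)).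
  rewrite -sumrN; apply: ler_sum => a _; rewrite -sumrN big_seq [leRHS]big_seq.
  by apply: ler_sum => w; rewrite mem_words => /eqP; exact: pt.
apply: (le_trans bound).
rewrite (eq_bigr _ (fun a _ => big_split _ _ _ _ _)) /= big_split /=.
rewrite (eq_bigr _ (fun a _ => big_split _ _ _ _ _)) /= big_split /=.
have -> : \sum_a \sum_(w <- words _ L) - (r a w * ln (p w)) = xent L p p.
  by rewrite /xent -(sumr_w (fun w => ln (p w))) -sumrN; apply: eq_bigr => a _; rewrite sumrN.
have hQ : \sum_a \sum_(w <- words _ L) (Q a w - r a w) <= 0.
  under eq_bigr do rewrite sumrB.
  rewrite sumrB sumr1 subr_le0 exchange_big /= -(inv_sum L ip).
  by apply: ler_sum => w _; exact: sumQ.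
have hS : \sum_a \sum_(w <- words _ L) \sum_i
      (t * (r a w * c a w i) + r a w * (M.+1%:R * expR (- t)))
    <= n%:R * (t * eta + M.+1%:R * expR (- t)).
  under eq_bigr do rewrite exchange_big.
  set V := t * eta + _; have -> : n%:R * V = \sum_(i < n) V.
    by rewrite sumr_const card_ord mulr_natl.
  rewrite exchange_big /=.
  apply: ler_sum => i _; under eq_bigr do rewrite big_split /= -mulr_sumr -mulr_suml.
  rewrite big_split /= -mulr_sumr -mulr_suml sumr1 mul1r lerD2r.
  by rewrite ler_wpM2l.
lra.
Qed.

(** After division by [n] there remain the entropy rate, a vanishing contribution of the [N] extra
    letters, and an error per letter of at most [e]. *)
Lemma part_entropy_cells_le :
  part_entropy m cells <= xent_rate (mass m) (mass m).
Proof.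
rewrite /part_entropy; set u := (X in limn X).
(* A divergent sequence has the junk limit 0, which is below the rate as well. *)
have [cu|/dvgP ->] := pselect (cvgn u); last exact: entropy_rate_ge0.
apply/ler_addgt0Pr => e e0; have e20 : 0 < e / 2 by rewrite divr_gt0.
(* As [e^t >= 1 + t], this [t] makes [M.+1 * e^-t] at most [e / 2]; a mismatch bound of [e / 2 / t]
   makes the other error [e / 2]. *)
pose t := M.+1%:R / (e / 2) : R; have t0 : 0 < t by rewrite divr_gt0.
have expt : M.+1%:R * expR (- t) <= e / 2.
  rewrite expRN ler_pdivrMr ?expR_gt0 // -ler_pdivrMl // mulrC -/t.
  by apply: le_trans (expR_ge1Dx t); rewrite lerDr.
have [N [beta h]] := partition_approx m ma (divr_gt0 e20 t0).
have bound n : (0 < n)%N -> u n <= n%:R^-1 * xent n (mass m) (mass m)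
    + n%:R^-1 * xent N (mass m) (mass m) + e.
  move=> n0; have np : 0 < n%:R :> R by rewrite ltr0n.
  have J := join_entropy_le n (ltW t0) h.
  rewrite [t * _]mulrC divfK ?gt_eqF // in J.
  rewrite -mulrDr -[X in _ + X](mulKf (lt0r_neq0 np)) -mulrDr ler_pM2l ?invr_gt0 //.
  apply: (le_trans J); apply: lerD; first exact: xent_subadd.
  by rewrite ler_wpM2l // [leRHS]splitr lerD2l.
have [_ c] := entropy_rate_spec ip.
have c2 : (fun n : nat => n%:R^-1 * xent n (mass m) (mass m)
    + n%:R^-1 * xent N (mass m) (mass m) + e) @ \oo --> xent_rate (mass m) (mass m) + e.
  apply: cvgD; last exact: cvg_cst.
  rewrite -[X in _ --> X]addr0; apply: cvgD => //.
  by rewrite -(mul0r (xent N (mass m) (mass m))); apply: cvgMr_tmp; exact: cvg_invn0.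
rewrite -(cvg_lim _ c2) //; apply: ler_lim => //.
  by apply/cvg_ex; eexists; exact: c2.
by exists 1%N => // n /=; exact: bound.
Qed.

End Partition.

Lemma part_entropy_le M (A : 'I_M -> set (Shift k)) : meas_partition A ->
  part_entropy m A <= xent_rate (mass m) (mass m).
Proof.
move=> [mA [disj cover]].
have /choice[alpha alphaP] : forall x, exists i, A i x.
  by move=> x; have : setT x by []; rewrite -cover => -[i _ Ai]; exists i.
(* The space has a point, so there is at least one label and [ord0] becomes available. *)
case: M A mA disj cover alpha alphaP => [A _ _ _ alpha _|M A mA disj _ alpha alphaP].
  by case: (alpha (spt k)).
have AE i : alpha @^-1` [set i] = A i.
  apply/seteqP; split=> x; first by move=> /= <-; exact: alphaP.
  move=> Ai; apply/eqP; apply: contraT => /(disj (alpha x) i) AB.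
  have : (A (alpha x) `&` A i) x by split=> //; exact: alphaP.
  by rewrite AB.
rewrite (_ : A = fun i => alpha @^-1` [set i]); last by apply/funext => i; rewrite AE.
by apply: part_entropy_cells_le => i; rewrite AE.
Qed.

(** The coordinate partition attains the supremum, its joins being the cylinders. *)
Lemma ks_entropyE : ks_entropy m = xent_rate (mass m) (mass m).
Proof.
rewrite /ks_entropy; set E := [set h | _].
have Eh : E (xent_rate (mass m) (mass m)).
  exists k.+1, coord_partition; split; first exact: meas_coord_partition.
  by rewrite part_entropy_coord.
have ubE : ubound E (xent_rate (mass m) (mass m)).
  by move=> _ [M [A [pA ->]]]; exact: part_entropy_le.
apply/eqP; rewrite eq_le; apply/andP; split.
  by apply: ge_sup => //; exists (xent_rate (mass m) (mass m)).
by apply: ub_le_sup => //; exists (xent_rate (mass m) (mass m)).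
Qed.

End KolmogorovSinai.

(** * The metric and measurability of continuous functions *)

Section ShiftDistance.
Variables (R : realType) (k : nat).
Implicit Types x : Shift k.

Lemma sdist_le j x x' : block j x = block j x' -> sdist R x x' <= (2^-1) ^+ j.
Proof.
move=> /blockP e; rewrite /sdist; case: pselect => [H|_]; last by rewrite exprn_ge0.
case: ex_minnP => i xi _; rewrite ler_wiXn2l ?invr_ge0 ?invf_le1 ?ler1n //.
by rewrite leqNgt; apply: contra xi => /e ->.
Qed.

Lemma sdist_ge i x x' : x i != x' i -> (2^-1) ^+ i <= sdist R x x'.
Proof.
move=> xi; rewrite /sdist; case: pselect => [H|[]]; last by exists i.
by case: ex_minnP => j _ /(_ i xi) ji; rewrite ler_wiXn2l ?invr_ge0 ?invf_le1 ?ler1n.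
Qed.

Lemma half_expn_lt (e : R) : 0 < e -> exists j, (2^-1) ^+ j < e.
Proof.
move=> e0; have : (fun n => 2^-1 ^+ n : R) @ \oo --> (0 : R).
  by apply: cvg_expr; rewrite ger0_norm ?invf_lt1 ?ltr1n // invr_ge0.
move=> /cvgrPdist_lt /(_ _ e0) [j _ /(_ j (leqnn j))] /=.
by rewrite sub0r normrN ger0_norm ?exprn_ge0 ?invr_ge0 //; exists j.
Qed.

(** A continuous function is the pointwise limit of functions of the first [j] letters, obtained by
    padding blocks with [ord0]. *)
Lemma measurable_dcont (h : Shift k -> R) : dcont h -> measurable_fun setT h.
Proof.
move=> hc; apply: (@measurable_fun_cvg _ _ R setT (fun j x => h (extend (block j x)))).
  by move=> j; exact: (@measurable_block k R j (fun w => h (extend w))).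
move=> x _; apply/cvgrPdist_le => e e0; have [del d0 hd] := hc x e e0.
have [N Nd] := half_expn_lt d0; exists N => // j /= Nj.
rewrite distrC ltW //; apply: hd; apply: le_lt_trans Nd.
have e1 : block j (extend (block j x)) = block j x.
  by have := block_extend (block j x); rewrite size_block.
by apply: sdist_le; rewrite -(take_block x Nj) -(take_block (extend _) Nj) e1.
Qed.

End ShiftDistance.

(** * Gibbs measures are quasi-Bernoulli *)

Section Gibbs.
Variables (R : realType) (k : nat) (f : nat -> Shift k -> R) (mu : probability (Shift k) R).
Hypotheses (fa : almost_additive f) (mui : shift_invariant mu) (gmu : gibbs f mu).

Let P := fine (top_pressure f).
Let q := mass mu.

Lemma gibbs_bounds : exists2 C : R, 1 < C & forall n x, (0 < n)%N ->
  C^-1 * (expR (- (n%:R * P)) * f n x) <= q (block n x) <=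
  C * (expR (- (n%:R * P)) * f n x).
Proof.
have [C h] := gmu; have f0 : forall n x, (0 < n)%N -> 0 < f n x by case: fa => _ [].
exists C => [|n x n0].
  (* The constant comes without a sign: a nonnegative ratio below [C] makes it positive, and then
     [C^-1 < C] forces [C > 1]. *)
  have /andP[h1 h2] := h (spt k) 1%N isT.
  have C0 : 0 < C.
    apply: le_lt_trans h2; apply: divr_ge0; first exact: fine_ge0.
    by rewrite mulr_ge0 ?expR_ge0 // ltW // f0.
  have := lt_trans h1 h2; rewrite ltNge => CC; rewrite ltNge; apply: contra CC => C1.
  by apply: (le_trans C1); rewrite invf_ge1.
have := h x n n0; rewrite cyl_wcyl -/(mass mu (block n x)) -/q.
have e0 : 0 < expR (- (n%:R * P)) * f n x by rewrite mulr_gt0 ?expR_gt0 ?f0.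
by rewrite ltr_pdivlMr // ltr_pdivrMr // => /andP[h1 h2]; rewrite !ltW.
Qed.

Lemma gibbs_mass_gt0 w : 0 < q w.
Proof.
have [C C1 h] := gibbs_bounds; have C0 := lt_trans ltr01 C1.
have [->|w0] := eqVneq w [::]; first by rewrite /q (inv_nil (mass_inv_dist mui)).
have sw : (0 < size w)%N by rewrite lt0n size_eq0.
have /andP[+ _] := h _ (extend w) sw; rewrite block_extend; apply: lt_le_trans.
by rewrite mulr_gt0 ?invr_gt0 // mulr_gt0 ?expR_gt0 //; case: fa => _ [f0 _]; exact: f0.
Qed.

Lemma gibbs_quasi_bernoulli : exists K, quasi_bernoulli q K.
Proof.
have [C C1 h] := gibbs_bounds; have C0 := lt_trans ltr01 C1.
have [_ [f0 [D D0 fD]]] := fa; have ip := mass_inv_dist mui.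
(* Three Gibbs bounds, for [s], [t] and [s ++ t], give [C ^+ 3]; almost additivity gives
   [expR D]. *)
pose K := C ^+ 3 * expR D.
have K1 : 1 <= K.
  by rewrite mulr_ege1 ?exprn_ege1 ?ltW // -expR0 ltr_expR.
have K0 : 0 <= K := le_trans ler01 K1.
have qge0 s : 0 <= q s := ltW (gibbs_mass_gt0 s).
(* The Gibbs bounds and almost additivity speak of positive lengths only, so empty words are treated
   apart. *)
have nil_cat s t : (s == [::]) || (t == [::]) -> q (s ++ t) = q s * q t.
  by case/orP => /eqP ->; rewrite ?cats0 (inv_nil ip : q [::] = 1) ?mul1r ?mulr1.
have split_point s t : ~~ ((s == [::]) || (t == [::])) -> exists n n' x,
    [/\ (0 < n)%N, (0 < n')%N, block n x = s, block n' (iter n (@shift k) x) = t &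
        block (n + n') x = s ++ t].
  rewrite negb_or -!size_eq0 -!lt0n => /andP[s0 t0].
  exists (size s), (size t), (extend (s ++ t)).
  have st : block (size s + size t) (extend (s ++ t)) = s ++ t.
    by rewrite -size_cat block_extend.
  have := st; rewrite {1}block_cat => /eqP.
  by rewrite eqseq_cat ?size_block // => /andP[/eqP ? /eqP ?].
have eD (n n' : nat) : expR (- ((n + n')%:R * P)) = expR (- (n%:R * P)) * expR (- (n'%:R * P)).
  by rewrite -expRD natrD mulrDl opprD.
exists K; split=> [s|s t|s t]; first exact: gibbs_mass_gt0.
- have [/nil_cat ->|/split_point[n [n' [x [n0 n'0 xs xt xst]]]]] := boolP ((s == [::]) || (t == [::])).
    by rewrite ler_peMl // mulr_ge0.
  have /andP[_ hs] := h n x n0; have /andP[_ ht] := h n' (iter n (@shift k) x) n'0.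
  have /andP[hst _] := h (n + n')%N x (ltn_addr _ n0).
  rewrite xs in hs; rewrite xt in ht; rewrite xst eD in hst.
  have [hf _] := fD n n' x n0 n'0.
  apply: le_trans (ler_pM (qge0 _) (qge0 _) hs ht) _.
  apply: le_trans (ler_wpM2l K0 hst).
  have E0 : 0 <= C ^+ 2 * expR (- (n%:R * P)) * expR (- (n'%:R * P)) * expR D.
    by rewrite !mulr_ge0 ?expR_ge0 // ltW.
  have := ler_wpM2l E0 hf; rewrite (expRN D) /K.
  rewrite [leLHS](_ : _ = C * (expR (- (n%:R * P)) * f n x)
    * (C * (expR (- (n'%:R * P)) * f n' (iter n (@shift k) x)))); last first.
    by field; rewrite gt_eqF ?expR_gt0.
  by move/le_trans; apply; rewrite [leRHS](_ : _ = C ^+ 2 * expR (- (n%:R * P))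
    * expR (- (n'%:R * P)) * expR D * f (n + n')%N x) //; field; rewrite gt_eqF.
- have [/nil_cat ->|/split_point[n [n' [x [n0 n'0 xs xt xst]]]]] := boolP ((s == [::]) || (t == [::])).
    by rewrite ler_peMl // mulr_ge0.
  have /andP[hs _] := h n x n0; have /andP[ht _] := h n' (iter n (@shift k) x) n'0.
  have /andP[_ hst] := h (n + n')%N x (ltn_addr _ n0).
  rewrite xs in hs; rewrite xt in ht; rewrite xst eD in hst.
  have [_ hf] := fD n n' x n0 n'0; apply: (le_trans hst).
  have pos a b : (0 < a)%N -> 0 <= C^-1 * (expR (- (a%:R * P)) * f a b).
    by move=> a0; rewrite !mulr_ge0 ?invr_ge0 ?expR_ge0 ?(ltW C0) ?(ltW (f0 _ _ _)).
  apply: le_trans (ler_wpM2l K0 (ler_pM (pos _ _ n0) (pos _ _ n'0) hs ht)).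
  have E0 : 0 <= C * expR (- (n%:R * P)) * expR (- (n'%:R * P)).
    by rewrite !mulr_ge0 ?expR_ge0 // ltW.
  have := ler_wpM2l E0 hf; rewrite /K.
  rewrite [leLHS](_ : _ = C * (expR (- (n%:R * P)) * expR (- (n'%:R * P)) * f (n + n')%N x)).
    by move/le_trans; apply; rewrite le_eqVlt; apply/orP; left; apply/eqP; field; rewrite gt_eqF.
  by ring.
Qed.

Lemma gibbs_ln : exists2 c : R, 0 <= c & forall n x, (0 < n)%N ->
  `|ln (f n x) - (n%:R * P + ln (q (block n x)))| <= c.
Proof.
have [C C1 h] := gibbs_bounds; have C0 := lt_trans ltr01 C1.
exists (ln C) => [|n x n0]; first by rewrite ln_ge0 // ltW.
have f0 : 0 < f n x by case: fa => _ [f0 _]; exact: f0.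
have e0 : 0 < expR (- (n%:R * P)) * f n x by rewrite mulr_gt0 ?expR_gt0.
have q0 := gibbs_mass_gt0 (block n x).
have lny : ln (expR (- (n%:R * P)) * f n x) = - (n%:R * P) + ln (f n x).
  by rewrite lnM ?posrE ?expR_gt0 // expRK.
move: (expR _ * _) e0 lny (h n x n0) => y y0 lny /andP[h1 h2].
have Cy : 0 < C^-1 * y by rewrite mulr_gt0 ?invr_gt0.
have h1' : ln (C^-1 * y) <= ln (q (block n x)) by rewrite ler_ln ?posrE.
have h2' : ln (q (block n x)) <= ln (C * y) by rewrite ler_ln ?posrE ?mulr_gt0.
rewrite lnM ?posrE ?invr_gt0 // lnV ?posrE // lny in h1'.
rewrite lnM ?posrE // lny in h2'.
by rewrite ler_norml; apply/andP; split; lra.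
Qed.

(** [ln (f n x)] is within [c] of a function of the first [n] letters with integral [n P - L_n]; the
    error vanishes after division by [n]. *)
Lemma integral_gibbs (mu' : probability (Shift k) R) : shift_invariant mu' ->
  limn (fun n : nat => ((n%:R)^-1)%:E * \int[mu']_x (ln (f n x))%:E)%E
  = (P - xent_rate (mass mu') q)%:E.
Proof.
move=> mui'; have ip := mass_inv_dist mui'; have iq := mass_inv_dist mui.
have [K bq] := gibbs_quasi_bernoulli; have [c c0 hc] := gibbs_ln.
pose I n := (\int[mu']_x (ln (f n x))%:E)%E.
pose F n (d : R) w := n%:R * P + ln (q w) + d.
have intF n d : (\int[mu']_x (F n d (block n x))%:E)%E = (n%:R * P - xent n (mass mu') q + d)%:E.
  rewrite integral_block; congr (_%:E); rewrite /F /xent opprK.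
  under eq_bigr do rewrite !mulrDr.
  by rewrite !big_split /= -!mulr_suml inv_sum // !mul1r.
have mlnf n : (0 < n)%N -> measurable_fun setT (fun x => ln (f n x)).
  move=> n0; apply: measurableT_comp; first exact: measurable_ln.
  by apply: measurable_dcont; case: fa => h _; exact: h.
have intlnf n : (0 < n)%N -> mu'.-integrable setT (fun x => (ln (f n x))%:E).
  move=> n0.
  apply: (le_integrable _ _ _
    (integrable_block mu' n (fun w => `|n%:R * P + ln (q w)| + c))) => //.
    by apply/measurable_EFinP; exact: mlnf.
  move=> x _; rewrite /= lee_fin [leRHS]ger0_norm ?addr_ge0 //.
  have := hc n x n0 => hx; rewrite -lerBlDl; apply: le_trans hx.
  by rewrite lerB_dist.
have Ib n : (0 < n)%N -> ((n%:R * P - xent n (mass mu') q - c)%:E <= I n <=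
    (n%:R * P - xent n (mass mu') q + c)%:E)%E.
  move=> n0; rewrite -!intF; apply/andP; split; apply: le_integral => //.
  - exact: integrable_block.
  - exact: intlnf.
  - move=> x _; rewrite lee_fin /F; have := hc n x n0.
    by rewrite ler_norml => /andP[]; lra.
  - exact: intlnf.
  - exact: integrable_block.
  - move=> x _; rewrite lee_fin /F; have := hc n x n0.
    by rewrite ler_norml => /andP[]; lra.
(* The index starts at 1, as nothing is known about [f 0]. *)
apply/cvg_lim => //; rewrite -cvg_shiftS /=.
have [_ cx] := xent_rate_spec ip iq bq.
have cvd d : (fun n => (n.+1%:R^-1 * (n.+1%:R * P - xent n.+1 (mass mu') q + d))%:E) @ \oo -->
    (P - xent_rate (mass mu') q)%:E.
  apply: cvg_EFin; first exact: nearW.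
  rewrite (_ : _ \o _ = (fun n => P - n.+1%:R^-1 * xent n.+1 (mass mu') q + n.+1%:R^-1 * d)); last first.
    by apply/funext => n /=; rewrite !mulrDr mulKf ?pnatr_eq0 // mulrN.
  rewrite (cvg_shiftS (fun n => P - n%:R^-1 * xent n (mass mu') q + n%:R^-1 * d)).
  rewrite -[P - xent_rate _ _]addr0; apply: cvgD.
    by apply: cvgB => //; exact: cvg_cst.
  by rewrite -(mul0r d); apply: cvgMr_tmp; exact: cvg_invn0.
apply: (squeeze_cvge _ (cvd (- c)) (cvd c)); apply: nearW => n.
have /andP[I1 I2] := Ib n.+1 isT.
by rewrite !EFinM; apply/andP; split; rewrite lee_wpmul2l.
Qed.

End Gibbs.

(** * Perturbation of upper limits *)

Section LimitSuperior.
Variable R : realType.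
Local Open Scope ereal_scope.
Implicit Types (u v : nat -> \bar R) (a : \bar R).

Lemma limn_esupE u : limn_esup u = ereal_inf (range (esups u)).
Proof. by rewrite limn_esup_lim; apply/cvg_lim => //; exact: cvg_esups_inf. Qed.

Lemma limn_esup_ub u a : (\forall n \near \oo, u n <= a) -> limn_esup u <= a.
Proof.
move=> [N _ h]; rewrite limn_esupE; apply: ereal_inf_le; exists (esups u N); first by exists N.
by apply: ub_ereal_sup => _ [n /= Nn <-]; exact: h.
Qed.

Lemma limn_esup_near_lt u a : limn_esup u < a -> \forall n \near \oo, u n < a.
Proof.
rewrite limn_esupE => /ereal_inf_lt[_ [N _ <-] h]; exists N => // n /= Nn.
by apply: le_lt_trans h; apply: ereal_sup_ubound; exists n.
Qed.

Lemma limn_esup_perturb_le (u v w : nat -> R) :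
  limn_esup (EFin \o v) \is a fin_num ->
  (\forall n \near \oo, (u n <= v n + w n)%R) -> w @ \oo --> (0%R : R) ->
  limn_esup (EFin \o u) <= limn_esup (EFin \o v).
Proof.
move=> vfin uvw w0; apply/lee_addgt0Pr => e e0.
have e20 : (0 < e / 2)%R by rewrite divr_gt0.
rewrite -(fineK vfin); set r := fine _.
have /limn_esup_near_lt vr : limn_esup (EFin \o v) < (r + e / 2)%:E.
  by rewrite -(fineK vfin) lte_fin ltrDl.
apply: limn_esup_ub.
move/cvgrPdist_lt : w0 => /(_ _ e20) w0.
near=> n.
have h1 : (u n <= v n + w n)%R by near: n.
have h2 : (EFin \o v) n < (r + e / 2)%:E by near: n.
have h3 : (`|0 - w n| < e / 2)%R by near: n.
rewrite sub0r normrN in h3; have h4 := le_lt_trans (ler_norm _) h3.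
by move: h2; rewrite /= lte_fin -EFinD lee_fin => h2; lra.
Unshelve. all: by end_near. Qed.

Lemma limn_esup_bounded (u : nat -> R) (B : R) :
  (\forall n \near \oo, `|u n| <= B)%R -> limn_esup (EFin \o u) \is a fin_num.
Proof.
move=> [N _ uB]; rewrite fin_numE; apply/andP; split.
  rewrite -ltNye ltNge; apply/negP => h.
  have : limn_esup (EFin \o u) < (- B - 1)%:E by apply: le_lt_trans h _; exact: ltNyr.
  move=> /limn_esup_near_lt[M _ /(_ (maxn N M) (leq_maxr _ _))] /=.
  have := uB _ (leq_maxl N M); rewrite ler_norml => /andP[h1 _].
  by rewrite lte_fin; lra.
rewrite -ltey; apply: (@le_lt_trans _ _ B%:E); last exact: ltry.
apply: limn_esup_ub; exists N => // n /= Nn; rewrite lee_fin.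
exact: le_trans (ler_norm _) (uB n Nn).
Qed.

(** Bounded multiplicative errors become null sequences after taking [ln] and dividing by [n]; this
    discards them. *)
Lemma limn_esup_perturb (u v w : nat -> R) (B : R) :
  (\forall n \near \oo, `|v n| <= B)%R ->
  (\forall n \near \oo, (`|u n - v n| <= w n)%R) -> w @ \oo --> (0%R : R) ->
  limn_esup (EFin \o u) = limn_esup (EFin \o v).
Proof.
move=> vB uvw w0; have vfin := limn_esup_bounded vB.
have ufin : limn_esup (EFin \o u) \is a fin_num.
  apply: (@limn_esup_bounded _ (B + 1)%R).
  move/cvgrPdist_lt : (w0) => /(_ _ ltr01) w1.
  near=> n.
  have h1 : (`|v n| <= B)%R by near: n.
  have h2 : (`|u n - v n| <= w n)%R by near: n.
  have h3 : (`|0 - w n| < 1)%R by near: n.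
  rewrite sub0r normrN in h3; have h4 := le_lt_trans (ler_norm _) h3.
  rewrite -[X in (`|X|)%R](subrK (v n)) addrC; apply: le_trans (ler_normD _ _) _.
  by apply: lerD => //; apply: le_trans h2 (ltW h4).
apply/eqP; rewrite eq_le; apply/andP; split; apply: limn_esup_perturb_le w0 => //.
- by near=> n; have : (`|u n - v n| <= w n)%R by [near: n]; rewrite ler_norml => /andP[]; lra.
- by near=> n; have : (`|u n - v n| <= w n)%R by [near: n]; rewrite ler_norml => /andP[]; lra.
Unshelve. all: by end_near. Qed.

End LimitSuperior.

(** * One-block factor maps and image measures *)

Section OneBlock.
Variables (R : realType) (k l : nat) (pi : Shift k -> Shift l).
Hypothesis opi : one_block_factor R pi.

(** The letter code of [pi], read off at constant points; [pi_symbol] carries it to every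
    coordinate, as [pi] commutes with the shifts. *)
Definition symbol_map (a : 'I_k.+1) : 'I_l.+1 := pi (fun=> a) 0%N.

Lemma pi_symbol x i : pi x i = symbol_map (x i).
Proof.
have [_ _ pis pi1] := opi.
have -> : pi x i = pi (iter i (@shift k) x) 0%N.
  have -> : pi (iter i (@shift k) x) = iter i (@shift l) (pi x).
    by elim: i => //= i <-; rewrite pis.
  by rewrite iter_shift addn0.
by apply: pi1; rewrite iter_shift addn0.
Qed.

Lemma symbol_section : exists psi, cancel psi symbol_map.
Proof.
have [_ psurj _ _] := opi.
suff /choice[psi h] : forall b, exists a, symbol_map a = b by exists psi.
by move=> b; have [x xb] := psurj (fun=> b); exists (x 0%N); rewrite -pi_symbol xb.
Qed.

Lemma block_pi n x : block n (pi x) = map symbol_map (block n x).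
Proof. by rewrite /block /mkseq -map_comp; apply: eq_map => i /=; rewrite pi_symbol. Qed.

Lemma pi_bset n P : pi @^-1` bset n P = bset n (fun w => P (map symbol_map w)).
Proof. by apply/funext => x; rewrite /bset /preimage /mkset block_pi. Qed.

Lemma measurable_pi : measurable_fun setT pi.
Proof.
apply: (measurability _ (@measurable_bsets l)) => _ [_ [n [P ->]] <-].
by rewrite setTI pi_bset; exact: measurable_bset.
Qed.

Section Push.
Variables (mu : probability (Shift k) R) (nu : probability (Shift l) R).
Hypothesis push : pushes_to pi mu nu.

Lemma pushes_invariant : shift_invariant mu -> shift_invariant nu.
Proof.
have [_ _ pis _] := opi; move=> mui A mA.
have mpiA : measurable (pi @^-1` A).
  by rewrite -[X in measurable X]setTI; exact: measurable_pi.
have mshA : measurable (@shift l @^-1` A).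
  by rewrite -[X in measurable X]setTI; exact: measurable_shift.
rewrite -(push mA) -(push mshA) -(mui _ mpiA); congr (mu _).
by apply/funext => x; rewrite /preimage /mkset pis.
Qed.

Lemma mass_push v : mass nu v =
  \sum_(w <- words _ (size v) | map symbol_map w == v) mass mu w.
Proof.
rewrite -fine_measure_bset /mass -push; last exact: measurable_wcyl.
congr (fine (mu _)); apply/seteqP; split=> x; rewrite /wcyl /bset /preimage /mkset block_pi.
  by move=> /eqP.
by move=> /eqP.
Qed.

(** The words over [s ++ t] are the concatenations of a word over [s] with a word over [t], so both
    inequalities sum over fibres with the same [K]. *)
Lemma quasi_bernoulli_push K : shift_invariant mu ->
  quasi_bernoulli (mass mu) K -> quasi_bernoulli (mass nu) K.
Proof.
move=> mui [q0 qsup qsub]; have [psi psiK] := symbol_section.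
have splitE s t (F : seq _ -> R) :
    \sum_(w <- words _ (size (s ++ t)) | map symbol_map w == s ++ t) F w
    = \sum_(u <- words _ (size s) | map symbol_map u == s)
      \sum_(v <- words _ (size t) | map symbol_map v == t) F (u ++ v).
  rewrite big_mkcond size_cat sum_words_cat [RHS]big_mkcond big_seq [RHS]big_seq.
  apply: eq_bigr => u; rewrite mem_words => /eqP us; rewrite [X in if _ then X else _]big_mkcond.
  under [LHS]eq_bigr do rewrite map_cat eqseq_cat ?size_map //.
  by case: eqP => // _; rewrite big1.
have prodE s t : mass nu s * mass nu t
    = \sum_(u <- words _ (size s) | map symbol_map u == s)
      \sum_(v <- words _ (size t) | map symbol_map v == t) mass mu u * mass mu v.
  by rewrite !mass_push mulr_suml; apply: eq_bigr => u _; rewrite mulr_sumr.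
split=> [s|s t|s t].
- rewrite mass_push big_mkcond; have := q0 (map psi s); move/lt_le_trans; apply.
  have := @sum_words_ge R _ (size s)
    (fun w => if map symbol_map w == s then mass mu w else 0) (map psi s).
  rewrite (mapK psiK) eqxx size_map; apply=> // v; case: ifP => // _; exact: ltW.
- rewrite prodE (mass_push (s ++ t)) splitE mulr_sumr; apply: ler_sum => u _.
  by rewrite mulr_sumr; apply: ler_sum => v _; exact: qsup.
- rewrite prodE (mass_push (s ++ t)) splitE mulr_sumr; apply: ler_sum => u _.
  by rewrite mulr_sumr; apply: ler_sum => v _; exact: qsub.
Qed.

End Push.
End OneBlock.

(** Prepending a letter costs at most [ln K] plus the sum of [- ln q] over all letters. The bound
    keeps the rates finite. *)
Lemma quasi_bernoulli_ln_bound (R : realType) (A : finType) (q : seq A -> R) K :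
  inv_dist q -> quasi_bernoulli q K ->
  exists2 c, 0 <= c & forall w, - ln (q w) <= (size w)%:R * c.
Proof.
move=> iq bq; have K1 := quasi_bernoulli_ge1 iq bq.
have lnq w : 0 <= - ln (q w) by rewrite oppr_ge0 ln_le0 // inv_le1.
have lnK : 0 <= ln K by rewrite ln_ge0.
pose c := ln K + \sum_a - ln (q [:: a]).
exists c => [|w]; first by rewrite addr_ge0 // sumr_ge0.
elim: w => [|a w IH]; first by rewrite (inv_nil iq) ln1 oppr0 mul0r.
have := ln_quasi_bernoulli_ge iq bq [:: a] w; rewrite cat1s => h.
have ha : - ln (q [:: a]) <= \sum_a - ln (q [:: a]).
  by rewrite (bigD1 a) //= lerDl sumr_ge0.
by rewrite [size _]/= -natr1 mulrDl mul1r; rewrite /c in IH *; lra.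
Qed.

Lemma sum_uniq_le (R : realType) (T : eqType) (r s : seq T) (F : T -> R) :
  uniq r -> uniq s -> {subset r <= s} -> (forall x, 0 <= F x) ->
  \sum_(x <- r) F x <= \sum_(x <- s) F x.
Proof.
move=> ur us rs F0; have pe : perm_eq r [seq x <- s | x \in r].
  apply: uniq_perm => //; first exact: filter_uniq.
  move=> x; rewrite mem_filter; case: (boolP (x \in r)) => //= xr.
  by rewrite rs.
by rewrite (perm_big _ pe) big_filter big_mkcond; apply: ler_sum => x _; case: ifP.
Qed.

(** * Separated sets and the relative pressure *)

Section Bowen.
Variables (R : realType) (k : nat).
Implicit Types x : Shift k.

Lemma bowen_ge1 n i x x' : (i < n)%N -> x i != x' i -> 1 <= bowen R n x x'.
Proof.
move=> ni xi.
apply: le_trans (le_bigmax _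
  (fun j : 'I_n => sdist R (iter j (@shift k) x) (iter j (@shift k) x')) (Ordinal ni)).
by rewrite -[leLHS](expr0 (2^-1 : R)); apply: sdist_ge; rewrite !iter_shift addn0.
Qed.

Lemma bowen_le n r x x' : block (n + r) x = block (n + r) x' ->
  bowen R n x x' <= (2^-1) ^+ r.
Proof.
move=> e; apply: bigmax_le => [|i _]; first by rewrite exprn_ge0 ?invr_ge0.
apply: sdist_le; apply/blockP => j jr; rewrite !iter_shift.
by move/blockP : e; apply; rewrite -addnS leq_add // ltnW.
Qed.

End Bowen.

Section RelativePressure.
Variables (R : realType) (k l : nat) (pi : Shift k -> Shift l) (f : nat -> Shift k -> R).
Variables (mu : probability (Shift k) R) (nu : probability (Shift l) R).
Hypotheses (opi : one_block_factor R pi) (fa : almost_additive f).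
Hypotheses (mui : shift_invariant mu) (gmu : gibbs f mu) (push : pushes_to pi mu nu).

Let P := fine (top_pressure f).
Let phi := symbol_map pi.

Let nui : shift_invariant nu := pushes_invariant opi push mui.

(** Each word over [block n y] is continued by a section of the letter map to a point over [y].
    Distinct words give points at Bowen distance at least 1, and their masses add up to that of the
    image cylinder. *)
Lemma sep_sup_ge : exists2 c : R, 0 < c & forall y n (eps : R), (0 < n)%N -> eps < 1 ->
  ((c * expR (n%:R * P) * mass nu (block n y))%:E
    <= sep_sup f (pi @^-1` [set y]) n eps)%E.
Proof.
have [psi psiK] := symbol_section opi; have [C C1 h] := gibbs_bounds fa gmu.
have C0 := lt_trans ltr01 C1.
exists C^-1 => [|y n eps n0 eps1]; first by rewrite invr_gt0.
pose lift w : Shift k := fun i => if (i < n)%N then nth ord0 w i else psi (y i).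
pose ws := [seq w <- words _ n | map phi w == block n y].
have liftB w : w \in ws -> block n (lift w) = w.
  rewrite mem_filter mem_words => /andP[_ /eqP wn].
  apply: (@eq_from_nth _ ord0); rewrite size_block ?wn // => i ni.
  by rewrite nth_block // /lift ni.
have liftpi w : w \in ws -> pi (lift w) = y.
  rewrite mem_filter mem_words => /andP[/eqP wy /eqP wn]; apply/funext => i.
  rewrite (pi_symbol opi) /lift; case: ifP => ni; last by rewrite psiK.
  by rewrite -(nth_block y ni) -wy (nth_map ord0) ?wn.
have uws : uniq ws by rewrite filter_uniq // words_uniq.
apply: (@ereal_sup_ge _ _ _); exists (\sum_(x <- map lift ws) f n x)%:E.
  exists (map lift ws) => //; split=> [i|i j ij]; rewrite size_map.
    by move=> iw; rewrite (nth_map [::]) //; apply: liftpi; exact: mem_nth.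
  move=> jw; have iw := ltn_trans ij jw; apply: (lt_le_trans eps1).
  rewrite !(nth_map [::]) //; set u := nth _ _ i; set v := nth _ _ j.
  have uv : u != v by rewrite nth_uniq // ltn_eqF.
  have uB : block n (lift u) = u by apply: liftB; exact: mem_nth.
  have vB : block n (lift v) = v by apply: liftB; exact: mem_nth.
  rewrite leNgt; apply/negP => lt1; move/eqP: uv; apply; rewrite -uB -vB.
  apply/blockP => t tn; apply/eqP; apply: contraT => tne.
  by have := bowen_ge1 R tn tne; rewrite leNgt lt1.
have -> : mass nu (block n y) = \sum_(w <- ws) mass mu w.
  by rewrite (mass_push opi push) size_block big_filter.
rewrite lee_fin big_map mulr_sumr.
rewrite big_seq [leRHS]big_seq; apply: ler_sum => w wws.
have /andP[_] := h n (lift w) n0; rewrite liftB // -/P expRN => hw.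
rewrite -mulrA ler_pdivrMl // -ler_pdivlMl ?expR_gt0 //.
by rewrite mulrCA.
Qed.

(** If [2^-r < eps], separated points have distinct blocks of length [n + r], so the number sharing
    their first [n] letters is bounded uniformly in [n] and [y]. *)
Lemma sep_sup_le (eps : R) : 0 < eps -> exists2 c : R, 0 < c & forall y n, (0 < n)%N ->
  (sep_sup f (pi @^-1` [set y]) n eps
    <= (c * expR (n%:R * P) * mass nu (block n y))%:E)%E.
Proof.
move=> eps0; have [C C1 h] := gibbs_bounds fa gmu; have C0 := lt_trans ltr01 C1.
have [r reps] := half_expn_lt eps0.
(* The sum counts the words of length [r]; the added 1 makes positivity immediate. *)
pose M : R := 1 + \sum_(v <- words 'I_k.+1 r) 1.
have M0 : 0 < M by rewrite ltr_pwDl // sumr_ge0.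
exists (C * M) => [|y n n0]; first by rewrite mulr_gt0.
apply: ub_ereal_sup => _ [E [EZ Esep] <-]; rewrite lee_fin.
pose F b := mass mu (take n b).
have F0 b : 0 <= F b by exact: fine_ge0.
have ub : uniq (map (block (n + r)) E).
  apply/(uniqP [::]) => i j; rewrite !inE size_map => iE jE.
  rewrite !(nth_map (spt k)) // => e.
  case: (ltngtP i j) => // ij.
    have := Esep i j ij jE; rewrite ltNge => /negP[].
    exact: le_trans (bowen_le R e) (ltW reps).
  have := Esep j i ij iE; rewrite ltNge => /negP[].
  exact: le_trans (bowen_le R (esym e)) (ltW reps).
apply: (@le_trans _ _ (C * expR (n%:R * P) * \sum_(b <- map (block (n + r)) E) F b)).
  rewrite big_map mulr_sumr; apply: ler_sum => x _.
  rewrite /F take_block ?leq_addr //; have /andP[+ _] := h n x n0.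
  rewrite -/P expRN ler_pdivrMl // ler_pdivrMl ?expR_gt0 // => hx.
  by rewrite mulrAC mulrC.
have key : \sum_(b <- map (block (n + r)) E) F b <= M * mass nu (block n y).
  have us : uniq [seq b <- words 'I_k.+1 (n + r) | map phi (take n b) == block n y].
    by rewrite filter_uniq // words_uniq.
  apply: le_trans (sum_uniq_le ub us _ F0) _.
    move=> b /(nthP [::])[i]; rewrite size_map => iE <-.
    rewrite (nth_map (spt k)) // mem_filter block_words andbT take_block ?leq_addr //.
    by rewrite -(block_pi opi) (EZ i iE).
  rewrite big_filter big_mkcond sum_words_cat (mass_push opi push) size_block mulr_sumr.
  rewrite [leRHS]big_mkcond big_seq [leRHS]big_seq; apply: ler_sum => u.
  rewrite mem_words => /eqP un; under eq_bigr do rewrite /F take_size_cat //.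
  case: ifP => _; last by rewrite big1.
  under eq_bigr do rewrite -[mass mu u]mul1r.
  by rewrite -mulr_suml ler_wpM2r ?fine_ge0 // /M lerDr.
rewrite (_ : C * M * _ * _ = C * expR (n%:R * P) * (M * mass nu (block n y))); last by ring.
by rewrite ler_wpM2l // mulr_ge0 ?expR_ge0 // ltW.
Qed.

Let qnu0 w : 0 < mass nu w.
Proof.
have [K bq] := gibbs_quasi_bernoulli fa mui gmu.
by have [] := quasi_bernoulli_push opi push mui bq.
Qed.

Let limsup_sep y (eps : R) : 0 < eps -> eps < 1 ->
  limn_esup (fun n => ((n%:R)^-1)%:E * lne (sep_sup f (pi @^-1` [set y]) n eps))%E
  = limn_esup (EFin \o (fun n => P + n%:R^-1 * ln (mass nu (block n y)))).
Proof.
move=> eps0 eps1; have [c1 c10 h1] := sep_sup_ge; have [c2 c20 h2] := sep_sup_le eps0.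
have [K bq] := gibbs_quasi_bernoulli fa mui gmu.
have inu := mass_inv_dist nui.
have [c c0 hc] := quasi_bernoulli_ln_bound inu (quasi_bernoulli_push opi push mui bq).
pose S n := fine (sep_sup f (pi @^-1` [set y]) n eps).
have SE n : (0 < n)%N -> sep_sup f (pi @^-1` [set y]) n eps = (S n)%:E.
  move=> n0; rewrite fineK // fin_real //; apply/andP; split.
    by apply: lt_le_trans (h1 y n eps n0 eps1); exact: ltNyr.
  by apply: le_lt_trans (h2 y n n0) _; exact: ltry.
have S0 n : (0 < n)%N -> 0 < S n.
  move=> n0; rewrite -lte_fin -SE //; apply: lt_le_trans (h1 y n eps n0 eps1).
  by rewrite lte_fin !mulr_gt0 ?expR_gt0.
rewrite (_ : (fun n => _) = EFin \o (fun n => n%:R^-1 * ln (S n))); last first.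
  apply/funext => n /=; have [->|n0] := posnP n; first by rewrite invr0 mul0e mul0r.
  by rewrite SE // lne_EFin ?S0.
apply: (@limn_esup_perturb _ _ _ (fun n => n%:R^-1 * (`|ln c1| + `|ln c2|)) (`|P| + c)).
- exists 1%N => // n /= n0; apply: (le_trans (ler_normD _ _)); rewrite lerD2l.
  have np : 0 < n%:R :> R by rewrite ltr0n.
  rewrite normrM ger0_norm ?invr_ge0 // ler_pdivrMl // -normrN ger0_norm.
    by have := hc (block n y); rewrite size_block.
  by rewrite oppr_ge0 ln_le0 // inv_le1.
- exists 1%N => // n /= n0; have np : 0 < n%:R :> R by rewrite ltr0n.
  have := h1 y n eps n0 eps1; have := h2 y n n0; rewrite SE // !lee_fin.
  rewrite -ler_ln ?posrE ?S0 ?mulr_gt0 ?expR_gt0 //.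
  rewrite 2?lnM ?posrE ?mulr_gt0 ?expR_gt0 // expRK => H2.
  rewrite -ler_ln ?posrE ?S0 ?mulr_gt0 ?expR_gt0 //.
  rewrite 2?lnM ?posrE ?mulr_gt0 ?expR_gt0 // expRK => H1.
  rewrite (_ : _ - _ = n%:R^-1 * (ln (S n) - (n%:R * P + ln (mass nu (block n y))))); last first.
    by rewrite mulrBr mulrDr mulKf ?gt_eqF.
  rewrite normrM ger0_norm ?invr_ge0 // ler_pM2l ?invr_gt0 //.
  have := ler_norm (ln c2); have := ler_norm (- ln c1); rewrite normrN => a1 a2.
  have := normr_ge0 (ln c1); have := normr_ge0 (ln c2) => b1 b2.
  by rewrite ler_norml; apply/andP; split; lra.
- by rewrite -(mul0r (`|ln c1| + `|ln c2|)); apply: cvgMr_tmp; exact: cvg_invn0.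
Qed.

(** For [0 < eps < 1] the two bounds on [sep_sup] differ by a factor independent of [n], so the
    upper limit does not depend on [eps] there and the limit at 0 is that of a constant. *)
Lemma rel_pressureE y : rel_pressure pi f y =
  limn_esup (EFin \o (fun n => P + n%:R^-1 * ln (mass nu (block n y)))).
Proof.
rewrite /rel_pressure /pressure_on; apply/cvg_lim => //; apply: cvg_near_cst.
near=> eps; apply: limsup_sep; first by near: eps; exact: nbhs_right_gt.
by near: eps; exact: nbhs_right_lt.
Unshelve. all: by end_near. Qed.

End RelativePressure.

(** * The integral of the pointwise rate *)

Section LowerRate.
Variables (R : realType) (k : nat) (m : probability (Shift k) R).
Variables (q : seq 'I_k.+1 -> R) (K : R).
Hypotheses (m_inv : shift_invariant m) (iq : inv_dist q) (bq : quasi_bernoulli q K).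
Implicit Types x : Shift k.

Let T := @shift k.
Let p := mass m.
Let ip : inv_dist p := mass_inv_dist m_inv.

Let a n x : R := - ln (q (block n x)).

(** For the masses of [nu] this is [P] minus the relative pressure; as a lower limit of nonnegative
    functions it suits Fatou's lemma. *)
Definition lower_rate x : \bar R :=
  limn_einf (EFin \o (fun n => - (n%:R^-1 * ln (q (block n x))))).

Let g x := fine (lower_rate x).

Let lnK : 0 <= ln K.
Proof. by rewrite ln_ge0 // (quasi_bernoulli_ge1 iq bq). Qed.

Let a_ge0 n x : 0 <= a n x.
Proof. by rewrite /a oppr_ge0 ln_le0 // inv_le1. Qed.

Let a_subadd n n' x : a (n + n') x <= a n x + a n' (iter n T x) + ln K.
Proof.
rewrite /a block_cat.
by have := ln_quasi_bernoulli_ge iq bq (block n x) (block n' (iter n T x)); lra.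
Qed.

Let a_superadd n n' x : a n x + a n' (iter n T x) - ln K <= a (n + n') x.
Proof.
rewrite /a block_cat.
by have := ln_quasi_bernoulli_le iq bq (block n x) (block n' (iter n T x)); lra.
Qed.

Let a_bound : exists2 c, 0 <= c & forall n x, a n x <= n%:R * c.
Proof.
have [c c0 h] := quasi_bernoulli_ln_bound iq bq; exists c => // n x.
by rewrite -[in n%:R](size_block n x); exact: h.
Qed.

Let upper x := limn_esup (EFin \o (fun n => n%:R^-1 * ln (q (block n x)))).

Let lower_rateN x : lower_rate x = (- upper x)%E.
Proof.
by rewrite -limn_einfN.
Qed.

Let upper_fin x : upper x \is a fin_num.
Proof.
have [c c0 h] := a_bound; apply: (@limn_esup_bounded _ _ c).
exists 1%N => // n /= n0; have np : 0 < n%:R :> R by rewrite ltr0n.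
rewrite normrM ger0_norm ?invr_ge0 // ler_pdivrMl // -normrN ger0_norm; [exact: h|exact: a_ge0].
Qed.

Let upperE x : upper x = (- g x)%:E.
Proof. by rewrite /g lower_rateN fineN opprK fineK. Qed.

Lemma lower_rateE x : lower_rate x = (fine (lower_rate x))%:E.
Proof. by rewrite fineK // lower_rateN fin_numN. Qed.

Lemma measurable_lower_rate : measurable_fun setT lower_rate.
Proof.
rewrite (_ : lower_rate = (fun x => - upper x)%E); last first.
  by apply/funext => x; rewrite lower_rateN.
apply: measurableT_comp => //.
apply: measurable_fun_limn_esup => n; apply/measurable_EFinP.
exact: (@measurable_block k R n (fun w => n%:R^-1 * ln (q w))).
Qed.

Let g_ge0 x : 0 <= g x.
Proof.
rewrite -oppr_le0 -lee_fin -upperE; apply: limn_esup_ub; apply: nearW => n /=.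
by rewrite lee_fin mulr_ge0_le0 ?invr_ge0 // ln_le0 // inv_le1.
Qed.

Let g_le_bound c : (forall n x, a n x <= n%:R * c) -> forall x, g x <= c.
Proof.
move=> h x; rewrite -lerN2 leNgt; apply/negP => lt.
have : (upper x < (- c)%:E)%E by rewrite upperE lte_fin.
move=> /limn_esup_near_lt[N _ /(_ N.+1 (leqnSn N))] /=; rewrite lte_fin.
by rewrite ltr_pdivrMl ?ltr0n // mulrN ltrNr ltNge h.
Qed.

Let limn_esup_shift (u : nat -> \bar R) : limn_esup (fun n => u n.+1) = limn_esup u.
Proof.
rewrite !limn_esup_lim (_ : esups (fun n => u n.+1) = fun n => esups u n.+1).
  apply/cvg_lim => //; rewrite (cvg_shiftS (esups u)); exact: is_cvg_esups.
apply/funext => N; congr ereal_sup; apply/seteqP; split=> _ [n /= Nn <-].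
  by exists n.+1.
by case: n Nn => // n Nn; exists n.
Qed.

(** Dropping the first letter loses [a 1 x >= 0] up to [ln K], which division by [n] makes
    invisible. A bound on [g] at [x] thus persists along its orbit. *)
Let g_shift x : g (T x) <= g x.
Proof.
have [c c0 h] := a_bound.
rewrite -lerN2 -lee_fin -!upperE /upper -(limn_esup_shift (EFin \o _)).
apply: (@limn_esup_perturb_le _ _ _ (fun n => n.+1%:R^-1 * (c + ln K))).
- exact: upper_fin.
- exists 1%N => // n /= n0; have np : 0 < n%:R :> R by rewrite ltr0n.
  have Sp : 0 < n.+1%:R :> R by rewrite ltr0n.
  have h1 := a_superadd 1 n x; rewrite add1n /= in h1; have h2 := a_ge0 1 x.
  have h3 : n%:R^-1 * a n (T x) <= c by rewrite ler_pdivrMl.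
  have ln_a i z : ln (q (block i z)) = - a i z by rewrite /a opprK.
  rewrite !ln_a !mulrN -(ler_pM2l Sp) mulrDr !mulrN !(mulVKf (lt0r_neq0 Sp)).
  rewrite -natr1 mulrDl mul1r (mulVKf (lt0r_neq0 np)).
  by move: h1 h2 h3; rewrite /a; lra.
- rewrite -(mul0r (c + ln K)); apply: cvgMr_tmp.
  by rewrite (cvg_shiftS (fun n => n%:R^-1 : R)); exact: cvg_invn0.
Qed.

Let g_iter n x : g (iter n T x) <= g x.
Proof. by elim: n => //= n IH; apply: le_trans IH; exact: g_shift. Qed.

Let measurable_g : measurable_fun setT g.
Proof. exact: measurableT_comp measurable_lower_rate. Qed.

Let integrable_g : m.-integrable setT (EFin \o g).
Proof.
have [c c0 h] := a_bound.
apply: (le_integrable _ _ _ (integrable_block m 0 (fun=> c))) => //.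
  exact/measurable_EFinP.
move=> x _; rewrite /= lee_fin ger0_norm // (le_trans (g_le_bound h x)) //.
exact: ler_norm.
Qed.

Lemma integrable_lower_rate : m.-integrable setT lower_rate.
Proof. by apply: (eq_integrable _ (EFin \o g)) => // x _; rewrite lower_rateE. Qed.

Let gm := fine (\int[m]_x (g x)%:E).

Let integral_g : (\int[m]_x (g x)%:E)%E = gm%:E.
Proof. by rewrite /gm fineK //; exact: integrable_fin_num. Qed.

Section Covering.
Variables (N0 : nat) (eps : R).
Hypotheses (N0_gt0 : (0 < N0)%N) (eps_gt0 : 0 < eps).

(** Points with no time in [[N0, M]] at which the rate is at most its lower limit plus [eps]. The
    lower limit being approached infinitely often, these sets decrease to the empty set. *)
Let bad M := [set x | forall n, (N0 <= n)%N -> (n <= M)%N -> n%:R * (g x + eps) < a n x].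

Let bad_empty : \bigcap_M bad M = set0.
Proof.
apply/seteqP; split=> x // hx.
have : (upper x <= (- (g x + eps))%:E)%E.
  apply: limn_esup_ub; exists N0 => // n /= Nn; rewrite lee_fin.
  have np : 0 < n%:R :> R by rewrite ltr0n (leq_trans N0_gt0).
  rewrite ler_pdivrMl // mulrN lerNr ltW //.
  exact: (hx n I n Nn (leqnn n)).
by rewrite upperE lee_fin lerN2 gerDl leNgt eps_gt0.
Qed.

Let measurable_bad M : measurable (bad M).
Proof.
rewrite (_ : bad M = \bigcap_(n in [set n | (N0 <= n <= M)%N])
  ((fun x => a n x - n%:R * (g x + eps)) @^-1` `]0, +oo[)); last first.
  apply/seteqP; split=> x h.
    by move=> n /= /andP[n0 nM]; rewrite in_itv /= andbT subr_gt0; exact: h.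
  by move=> n n0 nM; have := h n; rewrite /= in_itv /= andbT subr_gt0; apply; rewrite n0.
apply: bigcap_measurableType => n _; rewrite -[X in measurable X]setTI.
have mf : measurable_fun setT (fun x => a n x - n%:R * (g x + eps)).
  apply: measurable_funB; first exact: (@measurable_block k R n (fun w => - ln (q w))).
  by apply: measurable_funM => //; exact: measurable_funD.
by apply: mf => //; exact: measurable_itv.
Qed.

Let visits M n x : R := \sum_(i < n) \1_(bad M) (iter i T x).

Let visits_ge0 M n x : 0 <= visits M n x.
Proof. by apply: sumr_ge0 => i _; rewrite indicE. Qed.

Let visits_add M n n' x : visits M (n + n') x = visits M n x + visits M n' (iter n T x).
Proof.
rewrite /visits big_split_ord /=; congr (_ + _); apply: eq_bigr => i _.
by rewrite addnC iterD.
Qed.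

(* Katznelson-Weiss: cut the orbit segment into blocks of length in [N0, M] whose
   rate is at most G + eps, and into single symbols at the visits to bad M. *)
Let covering c M n x G : 0 <= c -> (forall n x, a n x <= n%:R * c) -> g x <= G ->
  a n x <= n%:R * (G + eps) + n%:R * (ln K / N0%:R) + (c + ln K) * visits M n x
           + M%:R * (c + ln K).
Proof.
(* [G] stays general because the induction moves to later points of the orbit, where [g] is only
   known to be at most its value at [x]. *)
move=> c0 hc; elim/ltn_ind: n x G => n IH x G gG.
have G0 : 0 <= G := le_trans (g_ge0 x) gG.
have N0p : 0 < N0%:R :> R by rewrite ltr0n.
have cK : 0 <= c + ln K by rewrite addr_ge0.
have K0 : 0 <= ln K / N0%:R by rewrite divr_ge0.
have [nM|Mn] := leqP n M.
  apply: (@le_trans _ _ (M%:R * (c + ln K))).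
    apply: (le_trans (hc n x)); apply: ler_pM => //; first by rewrite ler_nat.
    by rewrite lerDl.
  rewrite lerDr; apply: addr_ge0; last by rewrite mulr_ge0 ?visits_ge0.
  by apply: addr_ge0; rewrite mulr_ge0 // addr_ge0 // ltW.
(* A visit to [bad M] costs one letter and one junction, at most [c + ln K]. *)
have [xb|xnb] := pselect (bad M x).
  case: n Mn IH => // n _ IH.
  have := a_subadd 1 n x; rewrite add1n /= => h.
  have h1 := IH n (ltnSn n) (T x) G (le_trans (g_shift x) gG).
  have h2 := hc 1%N x; rewrite mul1r in h2.
  have h3 : visits M n.+1 x = 1 + visits M n (T x).
    by rewrite -add1n visits_add {1}/visits big_ord1 /= indicE mem_set.
  rewrite h3 -natr1; have h4 : 0 <= G + eps by rewrite addr_ge0 // ltW.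
  by move: (ln K / _) K0 h1 => kk K0 h1; rewrite -/T in h1 *; lra.
have [j [N0j jM aj]] : exists j, [/\ (N0 <= j)%N, (j <= M)%N & a j x <= j%:R * (g x + eps)].
  apply: contrapT => nex; apply: xnb => j N0j jM; rewrite ltNge; apply/negP => aj.
  by apply: nex; exists j.
have jn : (j < n)%N := leq_ltn_trans jM Mn.
have nE : n = (j + (n - j))%N by rewrite subnKC // ltnW.
have := a_subadd j (n - j) x; rewrite -nE => h.
have jp : (0 < j)%N := leq_trans N0_gt0 N0j.
have nj : (n - j < n)%N by rewrite ltn_subrL jp (leq_ltn_trans _ jn).
have h1 := IH (n - j)%N nj (iter j T x) G (le_trans (g_iter j x) gG).
have h2 : j%:R * (g x + eps) <= j%:R * (G + eps) by rewrite ler_wpM2l // lerD2r.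
(* A good block has length at least [N0], so its junction costs at most [ln K / N0] per letter. *)
have h3 : ln K <= j%:R * (ln K / N0%:R).
  by rewrite mulrCA ler_peMr // ler_pdivlMr // mul1r ler_nat.
have h4 : (c + ln K) * visits M (n - j) (iter j T x) <= (c + ln K) * visits M n x.
  by rewrite ler_wpM2l // [in leRHS]nE visits_add lerDr.
have nR : n%:R = j%:R + (n - j)%:R :> R by rewrite -natrD -nE.
by rewrite nR; move: (ln K / _) h1 h3 => kk h1 h3; lra.
Qed.

Let integrable_visits M n : m.-integrable setT (EFin \o visits M n).
Proof.
apply: (eq_integrable _ (fun x => \sum_(i < n) (\1_(iter i T @^-1` bad M) x)%:E)%E) => //.
  by move=> x _; rewrite /= sumEFin.
apply: integrable_sum => // i _; apply: integrable_indic.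
by rewrite -[X in measurable X]setTI; exact: measurable_iter_shift.
Qed.

Let integral_visits M n :
  (\int[m]_x (visits M n x)%:E)%E = (n%:R * fine (m (bad M)))%:E.
Proof.
have mi i : measurable (iter i T @^-1` bad M).
  by rewrite -[X in measurable X]setTI; exact: measurable_iter_shift.
rewrite (eq_integral (fun x => \sum_(i < n) (\1_(iter i T @^-1` bad M) x)%:E)%E); last first.
  by move=> x _; rewrite sumEFin.
rewrite integral_sum //; last by move=> i; exact: integrable_indic.
rewrite (eq_bigr (fun=> (fine (m (bad M)))%:E)) => [|i _]; last first.
  rewrite integral_indic // setIT fineK ?fin_num_measure //.
  exact: fine_measure_iter_shift.
by rewrite sumEFin sumr_const card_ord mulr_natl.
Qed.

(** The covering bound at [G = g x], integrated; by invariance the visits to [bad M] integrate to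
    [n] times its measure. *)
Let xent_covering c M n : 0 <= c -> (forall n x, a n x <= n%:R * c) ->
  xent n p q <= n%:R * (gm + (eps + ln K / N0%:R + (c + ln K) * fine (m (bad M))))
    + M%:R * (c + ln K).
Proof.
move=> c0 hc; pose D := n%:R * (eps + ln K / N0%:R) + M%:R * (c + ln K).
have ig : m.-integrable setT (fun x => n%:R%:E * (g x)%:E)%E by exact: integrableZl.
have iv : m.-integrable setT (fun x => (c + ln K)%:E * (visits M n x)%:E)%E.
  by apply: integrableZl => //; exact: integrable_visits.
have iD : m.-integrable setT (fun=> D%:E) := integrable_block m 0 (fun=> D).
have igv := integrableD measurableT ig iv.
have : (\int[m]_x (a n x)%:E <=
  \int[m]_x (n%:R%:E * (g x)%:E + (c + ln K)%:E * (visits M n x)%:E + D%:E))%E.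
  apply: le_integral => //.
  - exact: (integrable_block m n (fun w => - ln (q w))).
  - exact: integrableD.
  - move=> x _; rewrite -!EFinM -!EFinD lee_fin.
    by apply: le_trans (covering M n c0 hc (lexx (g x))) _; rewrite /D; lra.
rewrite (integral_block m n (fun w => - ln (q w))) integralD // integralD //.
rewrite integralZl // integralZl //; last exact: integrable_visits.
rewrite integral_g integral_visits (integral_block m 0 (fun=> D)) sum_words0.
rewrite (inv_nil (mass_inv_dist m_inv)) mul1r.
rewrite -!EFinM -!EFinD lee_fin /xent -sumrN.
under eq_bigr do rewrite mulrN.
move/le_trans; apply; rewrite /D; lra.
Qed.

Let bad_cvg : (fun M => fine (m (bad M))) @ \oo --> (0 : R).
Proof.
have : (m \o bad) @ \oo --> m (\bigcap_M bad M).
  apply: nonincreasing_cvg_mu => //.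
  - by rewrite -ge0_fin_numE // fin_num_measure.
  - by rewrite bad_empty.
  - move=> i j ij; apply/subsetPset => x bx n n0 ni.
    by apply: bx => //; exact: leq_trans ni ij.
by rewrite bad_empty measure0 => /fine_cvg.
Qed.

(** For fixed [M], division by [n] removes the boundary term; letting [M] grow then removes the bad
    set. *)
Lemma xent_rate_le_covering : xent_rate p q <= gm + (eps + ln K / N0%:R).
Proof.
have [c c0 hc] := a_bound; have [_ cx] := xent_rate_spec ip iq bq.
have bound M : xent_rate p q <= gm + (eps + ln K / N0%:R + (c + ln K) * fine (m (bad M))).
  set B := gm + _.
  have cB : (fun n : nat => B + n%:R^-1 * (M%:R * (c + ln K))) @ \oo --> B.
    rewrite -[X in _ --> X]addr0; apply: cvgD; first exact: cvg_cst.
    by rewrite -(mul0r (M%:R * (c + ln K))); apply: cvgMr_tmp; exact: cvg_invn0.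
  rewrite -(cvg_lim _ cx) // -(cvg_lim _ cB) //; apply: ler_lim.
  - by apply/cvg_ex; eexists; exact: cx.
  - by apply/cvg_ex; eexists; exact: cB.
  - exists 1%N => // n /= n0; have np : 0 < n%:R :> R by rewrite ltr0n.
    by rewrite ler_pdivrMl // mulrDr (mulVKf (lt0r_neq0 np)); exact: xent_covering.
have cB : (fun M => gm + (eps + ln K / N0%:R + (c + ln K) * fine (m (bad M)))) @ \oo
    --> gm + (eps + ln K / N0%:R).
  apply: cvgD; first exact: cvg_cst.
  rewrite -[X in _ --> X]addr0; apply: cvgD; first exact: cvg_cst.
  by rewrite -(mulr0 (c + ln K)); apply: cvgMl_tmp; exact: bad_cvg.
rewrite -(cvg_lim _ cB) //; apply: limr_ge; first by apply/cvg_ex; eexists; exact: cB.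
by apply: nearW => M; exact: bound.
Qed.

End Covering.

Lemma integral_lower_rate : (\int[m]_x lower_rate x)%E = (xent_rate p q)%:E.
Proof.
have [_ cx] := xent_rate_spec ip iq bq.
apply/eqP; rewrite eq_le; apply/andP; split.
  have mf n : measurable_fun setT (fun x => (- (n%:R^-1 * ln (q (block n x))))%:E).
    by apply/measurable_EFinP; exact: (@measurable_block k R n (fun w => - (n%:R^-1 * ln (q w)))).
  apply: le_trans (fatou m measurableT mf _) _.
    move=> n x _; rewrite lee_fin oppr_ge0 mulr_ge0_le0 ?invr_ge0 //.
    by rewrite ln_le0 // inv_le1.
  rewrite (_ : (fun n => _) = EFin \o (fun n => n%:R^-1 * xent n p q)); last first.
    apply/funext => n; rewrite (integral_block m n (fun w => - (n%:R^-1 * ln (q w)))) /=.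
    rewrite /xent mulrN mulr_sumr -sumrN; congr (_%:E); apply: eq_bigr => w _.
    by rewrite mulrN mulrCA.
  have cE : (EFin \o (fun n => n%:R^-1 * xent n p q)) @ \oo --> (xent_rate p q)%:E.
    by apply: cvg_EFin => //; exact: nearW.
  by have [-> _] := cvg_limn_einf_sup cE.
rewrite (eq_integral (fun x => (g x)%:E)); last by move=> x _; rewrite lower_rateE.
rewrite integral_g lee_fin; apply/ler_addgt0Pr => e e0.
have e20 : 0 < e / 2 by rewrite divr_gt0.
(* Chosen so that the junctions cost at most [e / 2] per letter. *)
pose N0 := (Num.truncn (ln K / (e / 2))).+1.
have N0p : 0 < N0%:R :> R by rewrite ltr0n.
apply: le_trans (@xent_rate_le_covering N0 (e / 2) isT e20) _.
rewrite lerD2l [leRHS]splitr lerD2l ler_pdivrMr // mulrC -ler_pdivrMr //.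
by apply: ltW; exact: truncnS_gt.
Qed.

End LowerRate.

(** * The two functionals as differences of rates, and the theorem *)

Section EquilibriumFunctionals.
Variables (R : realType) (k l : nat) (pi : Shift k -> Shift l) (f : nat -> Shift k -> R).
Variables (mu : probability (Shift k) R) (nu : probability (Shift l) R).
Hypotheses (opi : one_block_factor R pi) (fa : almost_additive f).
Hypotheses (mui : shift_invariant mu) (gmu : gibbs f mu) (push : pushes_to pi mu nu).

Let P := fine (top_pressure f).

Lemma eq_functionalE (m : probability (Shift l) R) : shift_invariant m ->
  eq_functional pi f m
  = (P + (xent_rate (mass m) (mass m) - xent_rate (mass m) (mass nu)))%:E.
Proof.
move=> mi; have nui := pushes_invariant opi push mui; have inu := mass_inv_dist nui.
have [K bq] := gibbs_quasi_bernoulli fa mui gmu.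
have bnu := quasi_bernoulli_push opi push mui bq.
have rpE y : rel_pressure pi f y = (P%:E - lower_rate (mass nu) y)%E.
  rewrite (rel_pressureE opi fa mui gmu push) /lower_rate.
  rewrite -[LHS]oppeK -limn_einfN; set u := (X in limn_einf X).
  rewrite (_ : u = (fun n => (- P)%:E + (- (n%:R^-1 * ln (mass nu (block n y))))%:E)%E).
    by rewrite limn_einf_shift // oppeD // EFinN oppeK.
  by apply/funext => n; rewrite /u /= opprD.
rewrite /eq_functional (ks_entropyE mi) (eq_integral _ _ (fun y _ => rpE y)).
have iP : m.-integrable setT (fun=> P%:E) := integrable_block m 0 (fun=> P).
rewrite integralB //; last exact: (integrable_lower_rate m inu bnu).
rewrite (integral_lower_rate mi inu bnu) (integral_block m 0 (fun=> P)) sum_words0.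
by rewrite (inv_nil (mass_inv_dist mi)) mul1r -EFinB -EFinD addrCA addrA.
Qed.

Lemma rel_functionalE (mu' : probability (Shift k) R) : shift_invariant mu' ->
  rel_functional f mu' nu = (P - xent_rate (mass nu) (mass nu)
    + (xent_rate (mass mu') (mass mu') - xent_rate (mass mu') (mass mu)))%:E.
Proof.
move=> mi; have nui := pushes_invariant opi push mui.
rewrite /rel_functional (integral_gibbs fa mui gmu mi) (ks_entropyE mi) (ks_entropyE nui).
by rewrite -EFinD /P; congr (_%:E); lra.
Qed.

End EquilibriumFunctionals.

Theorem theorem4p8 (R : realType) (k l : nat)
  (pi : Shift k -> Shift l) (f : nat -> Shift k -> R)
  (mu : probability (Shift k) R) (nu : probability (Shift l) R) :
  one_block_factor R pi ->
  almost_additive f ->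
  bounded_var_potential f ->
  shift_invariant mu -> gibbs f mu ->
  pushes_to pi mu nu ->
  (* nu is the unique equilibrium state for P(sigma_X, pi, F) *)
  [/\ shift_invariant nu,
      (forall m : probability (Shift l) R, shift_invariant m ->
         (eq_functional pi f m <= eq_functional pi f nu)%E),
      (forall m : probability (Shift l) R, shift_invariant m ->
         eq_functional pi f m = eq_functional pi f nu -> same_measure m nu),
  (* mu is the unique relative equilibrium state for F over nu *)
      (forall mu' : probability (Shift k) R, shift_invariant mu' ->
         pushes_to pi mu' nu ->
         (rel_functional f mu' nu <= rel_functional f mu nu)%E) &
      (forall mu' : probability (Shift k) R, shift_invariant mu' ->
         pushes_to pi mu' nu ->
         rel_functional f mu' nu = rel_functional f mu nu ->
         same_measure mu' mu)].
Proof.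
move=> opi fa _ mui gmu push; have imu := mass_inv_dist mui.
have nui := pushes_invariant opi push mui; have inu := mass_inv_dist nui.
have [K bmu] := gibbs_quasi_bernoulli fa mui gmu.
have bnu := quasi_bernoulli_push opi push mui bmu.
have eqE m mi := @eq_functionalE R k l pi f mu nu opi fa mui gmu push m mi.
have relE m mi := @rel_functionalE R k l pi f mu nu opi fa mui gmu push m mi.
split=> // [m mi|m mi|m mi _|m mi _].
(* At [nu] itself the two rates coincide, so each claim is a comparison of rates at [m]. *)
- rewrite !eqE // lee_fin lerD2l subrr subr_le0.
  exact: entropy_rate_le (mass_inv_dist mi) inu bnu.
- rewrite !eqE // subrr => -[/addrI/eqP]; rewrite subr_eq0 => /eqP e.
  exact: mass_same_measure (entropy_rate_eq (mass_inv_dist mi) inu bnu e).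
- rewrite !relE // lee_fin lerD2l subrr subr_le0.
  exact: entropy_rate_le (mass_inv_dist mi) imu bmu.
- rewrite !relE // subrr => -[/addrI/eqP]; rewrite subr_eq0 => /eqP e.
  exact: mass_same_measure (entropy_rate_eq (mass_inv_dist mi) imu bmu e).
Qed.
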